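(* For $d=0,1,2,3,4$ one has $\dim_kB_d=\dim_kS(1,1,1)_d$. In particular, $\dim_kB_4\ne\dim_kP_4$.
   Context: Let $k$ be an algebraically closed field of characteristic $0$, and let $\mathbb{P}^2=\mathbb{P}^2_k$ with homogeneous coordinates $[x:y:z]$. The degenerate Sklyanin algebra $S=S(1,1,1)$ is the graded $k$-algebra generated by $x,y,z$ in degree 1 subject to the relations $yz+zy+x^2=0$, $zx+xz+y^2=0$, $xy+yx+z^2=0$; $S(1,1,1)_d$ denotes its degree $d$ part. For $d\ge 1$, the truncated point scheme of length $d$ of $S$ is the closed subscheme $V_d\subseteq(\mathbb{P}^2)^{\times d}$ defined by the multilinearizations of the relations of $S$: writing a point of $(\mathbb{P}^2)^{\times d}$ as $(p_0,\dots,p_{d-1})$ with $p_i=[x_i:y_i:z_i]$, it is cut out by $f_i=g_i=h_i=0$ for $0\le i\le d-2$, where $f_i=y_iz_{i+1}+z_iy_{i+1}+x_ix_{i+1}$, $g_i=z_ix_{i+1}+x_iz_{i+1}+y_iy_{i+1}$, $h_i=x_iy_{i+1}+y_ix_{i+1}+z_iz_{i+1}$. In particular $V_1=\mathbb{P}^2$. Let $\zeta=e^{2\pi i/3}$ (a primitive cube root of unity in $k$). Set $p_a=[1:1:1]$, $p_b=[1:\zeta:\zeta^2]$, $p_c=[1:\zeta^2:\zeta]$. Define the projective lines in $\mathbb{P}^2$ $\mathbb{P}^1_A: x+y+z=0$, $\mathbb{P}^1_B: x+\zeta^2y+\zeta z=0$, $\mathbb{P}^1_C: x+\zeta y+\zeta^2z=0$.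 Set $W_1=\mathbb{P}^2$. For $d\ge 2$, $W_d\subseteq(\mathbb{P}^2)^{\times d}$ is the (reduced) union $W_d=\bigcup_{i=1}^6W_{d,i}$ of the six alternating products with $d$ factors $\mathbb{P}^1_A\times p_a\times\mathbb{P}^1_A\times p_a\times\cdots$, $\;p_a\times\mathbb{P}^1_A\times p_a\times\mathbb{P}^1_A\times\cdots$, $\mathbb{P}^1_B\times p_b\times\mathbb{P}^1_B\times p_b\times\cdots$, $\;p_b\times\mathbb{P}^1_B\times p_b\times\mathbb{P}^1_B\times\cdots$, $\mathbb{P}^1_C\times p_c\times\mathbb{P}^1_C\times p_c\times\cdots$, $\;p_c\times\mathbb{P}^1_C\times p_c\times\mathbb{P}^1_C\times\cdots$. For a closed subscheme $X\subseteq(\mathbb{P}^2)^{\times d}$, let $\mathcal{O}_X(\mathbf{1})=\mathcal{O}_X(1,\dots,1)$ be the restriction to $X$ of $pr_1^*\mathcal{O}_{\mathbb{P}^2}(1)\otimes\cdots\otimes pr_d^*\mathcal{O}_{\mathbb{P}^2}(1)$. The point parameter ring of $S(1,1,1)$ is the graded ring $B=\bigoplus_{d\ge 0}B_d$ with $B_d=H^0(V_d,\mathcal{O}_{V_d}(\mathbf{1}))$, and the point parameter ring associated to $\{W_d\}_{d\ge 1}$ is $P=\bigoplus_{d\ge 0}P_d$ with $P_d=H^0(W_d,\mathcal{O}_{W_d}(\mathbf{1}))$; by convention $B_0=P_0=k$. (In both rings, multiplication of degree $i$ and degree $j$ elements is given by pulling back sections along the projections to the first $i$ and last $j$ factors and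 tensoring.) *)

(* Defs.v *)
From HB Require Import structures.
From mathcomp Require Import all_boot all_order all_algebra.
From mathcomp Require monalg mpoly.

Set Implicit Arguments.
Unset Strict Implicit.
Unset Printing Implicit Defensive.

Import GRing.Theory.
Local Open Scope ring_scope.

Definition submod (k : nzRingType) (V : lmodType k) (U : V -> Prop) : Prop :=
  U 0 /\ forall (a : k) (u v : V), U u -> U v -> U (a *: u + v).

(* The k-vector space num / den, presented by subspaces den of num of V. *)
Record subquotient (k : nzRingType) (V : lmodType k) := Subquotient {
  num : V -> Prop;
  den : V -> Prop;
  num_submod : submod num;
  den_submod : submod den;
  den_num : forall v, den v -> num v }.

(* The classes of b 0, ..., b n.-1 form a basis of num Q / den Q. *)
Definition has_dim (k : nzRingType) (V : lmodType k) (Q : subquotient V)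
    (n : nat) : Prop :=
  exists b : 'I_n -> V,
    (forall i, num Q (b i)) /\
    forall v, num Q v ->
      exists! c : 'rV[k]_n, den Q (v - \sum_(i < n) c 0 i *: b i).

Record ideal (R : nzRingType) := Ideal {
  ideal_mem :> R -> Prop;
  ideal_mem0 : ideal_mem 0;
  ideal_memD : forall f g, ideal_mem f -> ideal_mem g -> ideal_mem (f + g);
  ideal_memM : forall a f b, ideal_mem f -> ideal_mem (a * f * b) }.

Inductive gen_mem (R : nzRingType) (G : R -> Prop) : R -> Prop :=
| gen_mem0 : gen_mem G 0
| gen_memD a g b f : G g -> gen_mem G f -> gen_mem G (a * g * b + f).

Section Generated.
Variables (R : nzRingType) (G : R -> Prop).

Lemma gen_mem_add f g : gen_mem G f -> gen_mem G g -> gen_mem G (f + g).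
Proof.
elim=> [|a h b f' Gh _ IH] Gg; first by rewrite add0r.
by rewrite -addrA; apply: gen_memD => //; apply: IH.
Qed.

Lemma gen_mem_mul a f b : gen_mem G f -> gen_mem G (a * f * b).
Proof.
elim=> [|c h d f' Gh _ IH]; first by rewrite mulr0 mul0r; constructor.
rewrite mulrDr mulrDl !mulrA -(mulrA _ d b).
by apply: gen_memD.
Qed.

Definition gen_ideal : ideal R :=
  Ideal (gen_mem0 G) gen_mem_add gen_mem_mul.

End Generated.

Section SklyaninAlgebra.
Import monalg.
Variable k : closedFieldType.

(* The free algebra k<x, y, z>: the monoid algebra of the free monoid on 'I_3,
   with x, y, z indexed by 0, 1, 2. *)
Local Notation free_alg := {malg k[{fmonom 'I_3}]}.

Definition letter (j : 'I_3) : free_alg := << fmu j >>.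

Definition sklyanin_rel (r : free_alg) : Prop :=
  let x := letter 0 in let y := letter 1 in let z := letter 2 in
  [\/ r = y * z + z * y + x ^+ 2,
      r = z * x + x * z + y ^+ 2
    | r = x * y + y * x + z ^+ 2].

Definition sklyanin_ideal : ideal free_alg := gen_ideal sklyanin_rel.

Definition free_homog (d : nat) (f : free_alg) : Prop :=
  forall w : {fmonom 'I_3}, f@_w != 0 -> fdeg w = d.

Lemma free_homog_submod d : submod (free_homog d).
Proof.
split=> [w|a u v hu hv w]; first by rewrite raddf0 eqxx.
rewrite raddfD /= mcoeffZ.
have [->|/hu //] := eqVneq u@_w 0.
by rewrite mulr0 add0r => /hv.
Qed.

Lemma sklyanin_den_submod d :
  submod (fun f => free_homog d f /\ sklyanin_ideal f).
Proof.
have [h0 hD] := free_homog_submod d.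
split=> [|a u v [hu Iu] [hv Iv]]; first by split=> //; apply: ideal_mem0.
split; first exact: hD.
apply: ideal_memD => //; rewrite -[u]mul1r scalerAl -[_ * u]mulr1.
exact: ideal_memM.
Qed.

(* S(1,1,1)_d = F_d / (F_d /\ J), for J the two-sided ideal of relations. *)
Definition sklyanin (d : nat) : subquotient free_alg :=
  Subquotient (free_homog_submod d) (sklyanin_den_submod d)
    (fun _ => @proj1 _ _).

End SklyaninAlgebra.

(* The notations of monalg and mpoly conflict. *)
Import mpoly.

Section RationalFunctions.
Variables (k : fieldType) (n : nat).

Definition ratfun := {fraction {mpoly k[n]}}.

HB.instance Definition _ := GRing.Field.on ratfun.

Definition to_rat : {mpoly k[n]} -> ratfun := @FracField.tofrac _.

HB.instance Definition _ := GRing.RMorphism.copy to_rat (@FracField.tofrac _).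

Lemma to_rat_eq0 p : (to_rat p == 0) = (p == 0).
Proof. exact: tofrac_eq0. Qed.

Definition ratfun_scale (c : k) (u : ratfun) : ratfun := to_rat c%:MP * u.

Lemma ratfun_scaleA c d u :
  ratfun_scale c (ratfun_scale d u) = ratfun_scale (c * d) u.
Proof. by rewrite /ratfun_scale mulrA -rmorphM /= mpolyCM. Qed.

Lemma ratfun_scale1 : left_id 1 ratfun_scale.
Proof. by move=> u; rewrite /ratfun_scale mpolyC1 rmorph1 mul1r. Qed.

Lemma ratfun_scaleDr : right_distributive ratfun_scale +%R.
Proof. by move=> c u v; rewrite /ratfun_scale mulrDr. Qed.

Lemma ratfun_scaleDl u : {morph ratfun_scale^~ u : c d / c + d}.
Proof. by move=> c d; rewrite /ratfun_scale mpolyCD rmorphD mulrDl. Qed.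

HB.instance Definition _ := GRing.Zmodule_isLmodule.Build k ratfun
  ratfun_scaleA ratfun_scale1 ratfun_scaleDr ratfun_scaleDl.

End RationalFunctions.

Section Sections.
Variables (k : closedFieldType) (d : nat).

(* Multihomogeneous coordinate ring of (P^2)^d; a closed subscheme of (P^2)^d is
   given by a multihomogeneous ideal of it. *)
Local Notation poly := {mpoly k[d * 3]}.
Local Notation rat := (ratfun k (d * 3)).

(* The homogeneous coordinates x_i, y_i, z_i of the i-th factor are
   hcoord i 0, hcoord i 1, hcoord i 2. *)
Definition hcoord (i : 'I_d) (j : 'I_3) : poly := 'X_(mxvec_index i j).

(* J stands for the standard affine open of (P^2)^d on which
   hcoord i (J i) != 0 for all i, i.e. the locus chart_mon J != 0. *)
Definition chart := {ffun 'I_d -> 'I_3}.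

Definition chart_mon (J : chart) : poly := \prod_(i < d) hcoord i (J i).

(* f is multihomogeneous of multidegree (e, ..., e). *)
Definition multihomog (e : nat) (f : poly) : Prop :=
  forall m, m \in msupp f ->
    forall i : 'I_d, (\sum_(j < 3) m (mxvec_index i j) = e)%N.

(* The sections of O(1, ..., 1) on the open set J: the part of multidegree
   (1, ..., 1) of the localization at chart_mon J. *)
Definition twist1 (J : chart) (u : rat) : Prop :=
  exists e f, multihomog e.+1 f /\ u = to_rat f / to_rat (chart_mon J) ^+ e.

(* The localization at m of the ideal I. *)
Definition loc_ideal (I : ideal poly) (m : poly) (u : rat) : Prop :=
  exists e f, I f /\ u = to_rat f / to_rat m ^+ e.

Lemma chart_mon_neq0 J : chart_mon J != 0.
Proof.
apply/prodf_neq0 => i _; apply/eqP => /(congr1 (mcoeff U_(mxvec_index i (J i)))).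
by rewrite mcoeffX eqxx mcoeff0 => /eqP; rewrite oner_eq0.
Qed.

Lemma multihomogD e f g : multihomog e f -> multihomog e g ->
  multihomog e (f + g).
Proof.
move=> hf hg m /msuppD_le; rewrite mem_cat => /orP[/hf //|/hg //].
Qed.

Lemma multihomogM e1 e2 f g : multihomog e1 f -> multihomog e2 g ->
  multihomog (e1 + e2) (f * g).
Proof.
move=> hf hg m /msuppM_le/allpairsP[[m1 m2] /= [/hf h1 /hg h2 ->]] i.
rewrite -(h1 i) -(h2 i) -big_split /=; apply: eq_bigr => j _.
by rewrite mnmDE.
Qed.

Lemma multihomogC c : multihomog 0 c%:MP.
Proof.
move=> m; rewrite mcoeff_msupp mcoeffC.
case: (m =P 0%MM) => [-> _ i|_]; last by rewrite mulr0 eqxx.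
by apply: big1 => j _; rewrite mnm0E.
Qed.

Lemma multihomog_chart_mon J e : multihomog e (chart_mon J ^+ e).
Proof.
suff h1 : multihomog 1 (chart_mon J).
  elim: e => [|e IH]; first by rewrite expr0 -mpolyC1; apply: multihomogC.
  by rewrite exprS -add1n; apply: multihomogM.
have -> : chart_mon J = 'X_[(\sum_(i < d) U_(mxvec_index i (J i)))%MM].
  by rewrite /chart_mon -(big_morph _ (@mpolyXD _ _) (mpolyX0 _ _)).
move=> m; rewrite msuppX inE => /eqP -> i.
under eq_bigr => j _ do rewrite mnm_sumE.
rewrite exchange_big (bigD1 i) //= (bigD1 (J i)) //= mnm1E eqxx.
have index_inj : injective (uncurry (@mxvec_index d 3)).
  have [g fK _] := curry_mxvec_bij d 3.
  by apply: (can_inj (g := g)) => u; apply: fK.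
have index_eq (i1 i2 : 'I_d) (j1 j2 : 'I_3) :
    (mxvec_index i1 j1 == mxvec_index i2 j2) = ((i1, j1) == (i2, j2)).
  by apply/eqP/eqP => [/(index_inj (i1, j1) (i2, j2))|[-> ->]].
rewrite big1 ?addn0 => [|j jJ]; last first.
  by rewrite mnm1E index_eq xpair_eqE eqxx eq_sym (negbTE jJ).
rewrite big1 ?addn0 // => i' ii'; apply: big1 => j _.
by rewrite mnm1E index_eq xpair_eqE (negbTE ii').
Qed.

Lemma fracD (m : poly) (f g : poly) (e1 e2 : nat) (c : k) : m != 0 ->
  c *: (to_rat f / to_rat m ^+ e1) + to_rat g / to_rat m ^+ e2
    = to_rat (c%:MP * f * m ^+ e2 + g * m ^+ e1) / to_rat m ^+ (e1 + e2).
Proof.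
rewrite -to_rat_eq0 => m0; have mX e := expf_neq0 e m0.
rewrite -[c *: _]/(to_rat c%:MP * _) rmorphD 3!rmorphM 2!rmorphXn mulrA.
by rewrite addf_div ?mX // exprD.
Qed.

Lemma twist1_submod J : submod (twist1 J).
Proof.
split=> [|c u v [e [f [hf ->]]] [e' [g [hg ->]]]].
  exists 0%N, 0; split; first by move=> m; rewrite msupp0.
  by rewrite rmorph0 mul0r.
exists (e + e')%N, (c%:MP * f * chart_mon J ^+ e' + g * chart_mon J ^+ e).
split; last by rewrite fracD ?chart_mon_neq0.
apply: multihomogD.
- apply: (@multihomogM e.+1 e'); last exact: multihomog_chart_mon.
  exact: (@multihomogM 0 e.+1 _ _ (@multihomogC c) hf).
- rewrite addnC; apply: (@multihomogM e'.+1 e) => //; exact: multihomog_chart_mon.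
Qed.

Lemma loc_ideal_submod I m : m != 0 -> submod (loc_ideal I m).
Proof.
move=> m0; split=> [|c u v [e [f [If ->]]] [e' [g [Ig ->]]]].
  exists 0%N, 0; split; first exact: ideal_mem0.
  by rewrite rmorph0 mul0r.
exists (e + e')%N, (c%:MP * f * m ^+ e' + g * m ^+ e).
split; last by rewrite fracD.
apply: ideal_memD; first exact: ideal_memM.
by rewrite -[g]mul1r; apply: ideal_memM.
Qed.

(* Families of sections of O(1, ..., 1) on the charts whose restrictions to X
   agree on the overlaps, X being the closed subscheme with ideal I. *)
Definition cocycle (I : ideal poly) (s : {ffun chart -> rat}) : Prop :=
  (forall J, twist1 J (s J)) /\
  forall J J', loc_ideal I (chart_mon J * chart_mon J') (s J - s J').

(* The families whose restriction to X is zero. *)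
Definition zero_on (I : ideal poly) (s : {ffun chart -> rat}) : Prop :=
  cocycle I s /\ forall J, loc_ideal I (chart_mon J) (s J).

Lemma cocycle_submod I : submod (cocycle I).
Proof.
have mm0 J J' : chart_mon J * chart_mon J' != 0.
  by rewrite mulf_neq0 ?chart_mon_neq0.
split=> [|c u v [hu Cu] [hv Cv]].
  split=> [J|J J']; rewrite !ffunE ?subrr.
    exact: (twist1_submod J).1.
  exact: (loc_ideal_submod I (mm0 J J')).1.
split=> [J|J J']; rewrite !ffunE.
  exact: (twist1_submod J).2.
rewrite opprD addrACA -scalerBr.
exact: (loc_ideal_submod I (mm0 J J')).2.
Qed.

Lemma zero_on_submod I : submod (zero_on I).
Proof.
have lS J := loc_ideal_submod I (chart_mon_neq0 J).
split=> [|c u v [Cu Zu] [Cv Zv]].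
  by split=> [|J]; [exact: (cocycle_submod I).1 | rewrite ffunE; exact: (lS J).1].
split=> [|J]; first exact: (cocycle_submod I).2.
by rewrite !ffunE; apply: (lS J).2.
Qed.

(* H^0(X, O_X(1, ..., 1)) for the closed subscheme X of (P^2)^d with
   multihomogeneous ideal I: on the standard chart J this sheaf has sections
   twist1 J modulo loc_ideal I (chart_mon J), and global sections are glued from
   compatible sections on the charts. *)
Definition H0 (I : ideal poly) : subquotient {ffun chart -> rat} :=
  Subquotient (cocycle_submod I) (zero_on_submod I) (fun _ => @proj1 _ _).

Definition V_eq (p : poly) : Prop :=
  exists i i' : 'I_d, i' = i.+1 :> nat /\
    let x := hcoord^~ 0 in let y := hcoord^~ 1 in let z := hcoord^~ 2 in
    [\/ p = y i * z i' + z i * y i' + x i * x i',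
        p = z i * x i' + x i * z i' + y i * y i'
      | p = x i * y i' + y i * x i' + z i * z i'].

Definition V_ideal : ideal poly := gen_ideal V_eq.

(* vertex zeta t is p_a, p_b, p_c and on_side zeta t is the line P^1_A, P^1_B,
   P^1_C, for t = 0, 1, 2. *)
Definition vertex (zeta : k) (t : 'I_3) : 'rV[k]_3 :=
  \row_(j < 3) zeta ^+ (t * j).

Definition on_side (zeta : k) (t : 'I_3) (p : 'rV[k]_3) : Prop :=
  \sum_(j < 3) zeta ^- (t * j) * p 0 j = 0.

Definition same_point (p q : 'rV[k]_3) : Prop :=
  exists2 c : k, c != 0 & p = c *: q.

(* A tuple of points of P^2 is given by a matrix with nonzero rows. The value
   b = false selects side x vertex x side x ..., and b = true selects
   vertex x side x vertex x ... *)
Definition W_component (zeta : k) (t : 'I_3) (b : bool) (v : 'M[k]_(d, 3)) :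
    Prop :=
  forall i : 'I_d, if odd i == b then on_side zeta t (row i v)
                   else same_point (row i v) (vertex zeta t).

(* W_1 = P^2. For d = 0 the ambient space is a point, and so is W_0. *)
Definition W_point (zeta : k) (v : 'M[k]_(d, 3)) : Prop :=
  (forall i, row i v != 0) /\
  ((d <= 1)%N \/ exists t b, W_component zeta t b v).

(* All representatives of a point of W_d are tested. Since k is infinite, this
   makes the ideal multihomogeneous: it is generated by the multihomogeneous
   polynomials that vanish on W_d. *)
Definition W_mem (zeta : k) (f : poly) : Prop :=
  forall v : 'M[k]_(d, 3), W_point zeta v -> f.@[mxvec v 0] = 0.

Lemma W_mem0 zeta : W_mem zeta 0.
Proof. by move=> v _; rewrite raddf0. Qed.

Lemma W_memD zeta f g : W_mem zeta f -> W_mem zeta g -> W_mem zeta (f + g).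
Proof. by move=> hf hg v hv; rewrite mevalD hf ?hg ?addr0. Qed.

Lemma W_memM zeta a f b : W_mem zeta f -> W_mem zeta (a * f * b).
Proof. by move=> hf v hv; rewrite !mevalM hf // mulr0 mul0r. Qed.

Definition W_ideal (zeta : k) : ideal poly :=
  Ideal (@W_mem0 zeta) (@W_memD zeta) (@W_memM zeta).

End Sections.

(* For d = 0 both of these give k, as (P^2)^0 is the spectrum of k. *)
Definition ppr_B (k : closedFieldType) (d : nat) := H0 (V_ideal k d).
Definition ppr_P (k : closedFieldType) (zeta : k) (d : nat) :=
  H0 (W_ideal d zeta).

(* Main.v *)
Require Import Defs.
From HB Require Import structures.
From mathcomp Require Import all_boot all_order all_algebra.
From mathcomp Require monalg mpoly.
From mathcomp Require Import ring zify.

(* The discrete Fourier transform u_t = x + zeta^-t y + zeta^-2t z turns the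
   relations of S(1,1,1), which are convolutions over Z/3, into u_t u_t = 0.
   Hence S(1,1,1)_d has as a basis the words of length d in the u_t without two
   equal adjacent letters, and both V_d and W_d are, in the coordinates u_t on
   each factor, subschemes of (P^2)^d cut out by squarefree monomials, i.e.
   Stanley-Reisner schemes of simplicial complexes on [d] x [3]. For every such
   scheme, H^0 of O(1,...,1) has as a basis the multilinear monomials whose
   support is a face: given a section t_K on the chart where the monomial u_K is
   invertible, a monomial with a negative exponent of u_K(i) has a positive
   exponent of another u_j of the same factor, and comparison with the chart K'
   obtained from K by K'(i) = j shows that its coefficient vanishes. For V_d the
   faces are again the words without equal adjacent letters, and for W_4 they
   are fewer, since they do not contain the word u_0 u_1 u_2 u_0. *)

Set Implicit Arguments.
Unset Strict Implicit.
Unset Printing Implicit Defensive.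

Import GRing.Theory.
Local Open Scope ring_scope.

(** * Linear substitutions acting alike on all factors *)

Section RowSubstitution.
Import mpoly.
Variables (k : closedFieldType) (d : nat).
Local Notation poly := {mpoly k[d * 3]}.

(** The degree may vary with the factor, as it does for a single coordinate. For constant [e] this
    is [multihomog] by conversion, so the closure lemmas below apply to that notion too. *)
Definition row_homog (e : 'I_d -> nat) (f : poly) : Prop :=
  forall m, m \in msupp f ->
    forall i : 'I_d, (\sum_(j < 3) m (mxvec_index i j) = e i)%N.

Lemma row_homog_sum (I : Type) (r : seq I) (P : pred I) (F : I -> poly) e :
  (forall i, P i -> row_homog e (F i)) ->
  row_homog e (\sum_(i <- r | P i) F i).
Proof.
move=> hF; apply: (big_ind (row_homog e)) => // [m|f g hf hg m].
  by rewrite msupp0.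
by move=> /msuppD_le; rewrite mem_cat => /orP[/hf|/hg].
Qed.

Lemma row_homogZ e c f : row_homog e f -> row_homog e (c *: f).
Proof. by move=> hf m /msuppZ_le /hf. Qed.

Lemma row_homogB e f g : row_homog e f -> row_homog e g -> row_homog e (f - g).
Proof.
by move=> hf hg m /msuppB_le; rewrite mem_cat => /orP[/hf|/hg].
Qed.

Lemma row_homogM e1 e2 f g : row_homog e1 f -> row_homog e2 g ->
  row_homog (fun i => e1 i + e2 i)%N (f * g).
Proof.
move=> hf hg m /msuppM_le/allpairsP[[m1 m2] /= [/hf h1 /hg h2 ->]] i.
rewrite -(h1 i) -(h2 i) -big_split /=; apply: eq_bigr => j _.
by rewrite mnmDE.
Qed.

Lemma row_homog1 : row_homog (fun=> 0%N) 1.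
Proof. exact: (@multihomogC k d 1). Qed.

Lemma row_homogX e f n : row_homog e f ->
  row_homog (fun i => n * e i)%N (f ^+ n).
Proof.
move=> hf; elim: n => [|n IH]; first exact: row_homog1.
move=> m; rewrite exprS => /(row_homogM hf IH) hm i.
by rewrite hm mulSn.
Qed.

Lemma row_homog_prod (I : Type) (r : seq I) (F : I -> poly) e :
  (forall i, row_homog (e i) (F i)) ->
  row_homog (fun a => \sum_(i <- r) e i a)%N (\prod_(i <- r) F i).
Proof.
move=> hF; elim: r => [|i r IH] m; rewrite ?big_nil ?big_cons.
  by move/row_homog1 => hm a; rewrite hm big_nil.
by move/(row_homogM (hF i) IH) => hm a; rewrite hm big_cons.
Qed.

Lemma mxvec_index_eq (i1 i2 : 'I_d) (j1 j2 : 'I_3) :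
  (mxvec_index i1 j1 == mxvec_index i2 j2) = ((i1, j1) == (i2, j2)).
Proof.
have [g fK _] := curry_mxvec_bij d 3.
apply/eqP/eqP => [h|[-> ->] //].
by rewrite -[RHS](fK (i2, j2)) //= -h (fK (i1, j1)).
Qed.

Lemma big_mxvec_index (R : Type) (x : R) (op : Monoid.com_law x)
    (F : 'I_(d * 3) -> R) :
  \big[op/x]_l F l = \big[op/x]_i \big[op/x]_j F (mxvec_index i j).
Proof.
rewrite (reindex (uncurry (@mxvec_index d 3))) /=; last first.
  exact: curry_mxvec_bij.
by rewrite (pair_bigA _ (fun i j => F (mxvec_index i j))) /=; apply: eq_bigr => -[].
Qed.

Lemma row_homog_hcoord i j : row_homog (fun a => (a == i : nat)) (hcoord k i j).
Proof.
move=> m; rewrite msuppX inE => /eqP -> a.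
rewrite (eq_bigr (fun j' => ((a == i) && (j' == j) : nat))) => [|j' _].
  case: (a == i); last by rewrite big1.
  rewrite (bigD1 j) //= eqxx big1 ?addn0 //= => j' /negbTE -> //.
by rewrite mnm1E mxvec_index_eq xpair_eqE eq_sym [j == _]eq_sym.
Qed.

Definition row_form (A : 'M[k]_3) : 'rV[poly]_(d * 3) :=
  mxvec (\matrix_(i < d, j < 3) \sum_t A j t *: hcoord k i t).

Definition row_subst (A : 'M[k]_3) : poly -> poly :=
  comp_mpoly [tuple row_form A 0 l | l < d * 3].

HB.instance Definition _ A := GRing.RMorphism.copy (row_subst A) (comp_mpoly _).
HB.instance Definition _ A := GRing.Linear.copy (row_subst A) (comp_mpoly _).

Lemma row_subst_hcoord A i j :
  row_subst A (hcoord k i j) = \sum_t A j t *: hcoord k i t.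
Proof. by rewrite /row_subst comp_mpolyXU -tnth_nth tnth_mktuple mxvecE mxE. Qed.

Lemma monomE (m : 'X_{1..d * 3}) :
  'X_[m] = \prod_i \prod_j hcoord k i j ^+ m (mxvec_index i j) :> poly.
Proof. by rewrite mpolyXE_id big_mxvec_index. Qed.

Lemma row_substX A m :
  row_subst A 'X_[m] =
  \prod_i \prod_j (\sum_t A j t *: hcoord k i t) ^+ m (mxvec_index i j).
Proof.
rewrite monomE rmorph_prod; apply: eq_bigr => i _.
rewrite rmorph_prod; apply: eq_bigr => j _.
by rewrite rmorphXn /= row_subst_hcoord.
Qed.

Lemma row_substE A f :
  row_subst A f = \sum_(m <- msupp f) f@_m *: row_subst A 'X_[m].
Proof. exact: comp_mpolyEX. Qed.

(** Row [j] of [A] holds the form replacing coordinate [j], and substituting [B] into that form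
    gives row [j] of [A *m B]. *)
Lemma row_subst_comp A B f : row_subst B (row_subst A f) = row_subst (A *m B) f.
Proof.
rewrite [row_subst A f]row_substE [RHS]row_substE linear_sum /=.
apply: eq_bigr => m _.
rewrite linearZ /= !row_substX rmorph_prod; congr (_ *: _).
apply: eq_bigr => i _; rewrite rmorph_prod; apply: eq_bigr => j _.
rewrite rmorphXn /= linear_sum /=; congr (_ ^+ _).
under eq_bigr => t _ do rewrite linearZ /= row_subst_hcoord scaler_sumr.
rewrite exchange_big; apply: eq_bigr => s _ /=.
by rewrite mxE scaler_suml; apply: eq_bigr => t _; rewrite scalerA.
Qed.

Lemma row_subst1 f : row_subst 1%:M f = f.
Proof.
rewrite row_substE [RHS]mpolyE; apply: eq_bigr => m _.
rewrite row_substX monomE; congr (_ *: _).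
apply: eq_bigr => i _; apply: eq_bigr => j _; congr (_ ^+ _).
rewrite (bigD1 j) //= mxE eqxx scale1r big1 ?addr0 // => t.
by rewrite mxE eq_sym => /negbTE ->; rewrite scale0r.
Qed.

Lemma row_homog_subst A e f : row_homog e f -> row_homog e (row_subst A f).
Proof.
move=> hf; rewrite row_substE big_seq; apply: row_homog_sum => m hm.
apply: row_homogZ; rewrite row_substX.
have hform i j : row_homog (fun a => (a == i : nat))
    (\sum_t A j t *: hcoord k i t).
  by apply: row_homog_sum => t _; apply/row_homogZ/row_homog_hcoord.
have hprod := @row_homog_prod _ (index_enum _) _ _ (fun i =>
  @row_homog_prod _ (index_enum _) _ _ (fun j =>
    @row_homogX _ _ (m (mxvec_index i j)) (hform i j))).
move=> m' /hprod hm' a; rewrite {}hm' -(hf _ hm a) (bigD1 a) //=.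
rewrite [X in (_ + X)%N]big1 ?addn0 => [|i ai].
  by apply: eq_bigr => j _; rewrite eqxx muln1.
by apply: big1 => j _; rewrite eq_sym (negbTE ai) muln0.
Qed.

End RowSubstitution.

(** * Ideals of squarefree monomials *)

Section FaceIdeal.
Import mpoly.
Variables (k : closedFieldType) (d : nat).
Local Notation poly := {mpoly k[d * 3]}.
Local Notation chart := (chart d).

(** A chart picks one coordinate in each factor, so charts double as words of length [d] in three
    letters. *)
Definition word_mnm (K : chart) : 'X_{1..d * 3} :=
  (\sum_(i < d) U_(mxvec_index i (K i)))%MM.

Lemma word_mnmE K i j : word_mnm K (mxvec_index i j) = (j == K i) :> nat.
Proof.
rewrite mnm_sumE (bigD1 i) //= mnm1E mxvec_index_eq xpair_eqE eqxx eq_sym.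
rewrite big1 ?addn0 // => i' ii'.
by rewrite mnm1E mxvec_index_eq xpair_eqE (negbTE ii').
Qed.

Lemma word_mnm_inj : injective word_mnm.
Proof.
move=> K K' eqK; apply/ffunP => i; apply/eqP.
by have := word_mnmE K' i (K i); rewrite -eqK word_mnmE eqxx; case: (_ == _).
Qed.

Lemma word_mnmP (m : 'X_{1..d * 3}) :
  (forall i : 'I_d, \sum_(j < 3) m (mxvec_index i j) = 1)%N ->
  exists K, m = word_mnm K.
Proof.
(* The default [ord0] is never reached: the exponents in a factor sum to 1, so exactly one is
   nonzero. *)
move=> hm; exists [ffun i => odflt ord0 [pick j | m (mxvec_index i j) != 0%N]].
apply/mnmP => l; case/mxvec_indexP: l => i j; rewrite word_mnmE ffunE.
move: (hm i); case: pickP => [j0 /= m0|none]; last first.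
  by rewrite big1 // => j' _; apply/eqP/negbFE/none.
rewrite (bigD1 j0) //=; have [->|jj0] := eqVneq j j0; first by case: (m _) m0 => [|[]].
by rewrite (bigD1 j) //=; lia.
Qed.

Lemma chart_monE K : chart_mon k K = 'X_[word_mnm K].
Proof. by rewrite /chart_mon -(big_morph _ (@mpolyXD _ _) (mpolyX0 _ _)). Qed.

Lemma mcoeff_chart_monX K n (p : poly) m :
  (chart_mon k K ^+ n * p)@_(word_mnm K *+ n + m) = p@_m.
Proof. by rewrite chart_monE mpolyXn mulrC mcoeffMX. Qed.

Lemma mcoeff_chart_monX_eq0 (K : chart) n (p : poly) (m : 'X_{1..d * 3}) i :
  (m (mxvec_index i (K i)) < n)%N ->
  (chart_mon k K ^+ n * p)@_m = 0.
Proof.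
move=> mn; apply/eqP; rewrite mcoeff_eq0 chart_monE mpolyXn mulrC.
rewrite (perm_mem (msuppMX _ _)); apply: contraTN mn => /mapP[m' _ ->].
by rewrite mnmDE mulmnE word_mnmE eqxx mul1n -leqNgt leq_addr.
Qed.

(** Three exponents with sum at least [3 * E] cannot all be below [E]. Hence every monomial of [g]
    is divisible by the [E]-th power of some chart monomial, and the monomials are sorted by such a
    chart. *)
Lemma pigeonhole_charts E M g : multihomog M g -> (3 * E <= M)%N ->
  exists a : chart -> poly,
    (forall J, multihomog (M - E) (a J)) /\
    g = \sum_J a J * chart_mon k J ^+ E.
Proof.
move=> hg EM.
pose Jm (m : 'X_{1..d * 3}) : chart :=
  [ffun i => odflt ord0 [pick j | E <= m (mxvec_index i j)]%N].
have JmP m : m \in msupp g -> (word_mnm (Jm m) *+ E <= m)%MM.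
  move=> mg; apply/mnm_lepP => l; case/mxvec_indexP: l => i j.
  rewrite mulmnE word_mnmE; have [->|] := eqVneq; last by rewrite mul0n.
  rewrite mul1n ffunE; case: pickP => //= none.
  have := hg m mg i; rewrite !big_ord_recl big_ord0.
  move: (none ord0) (none (lift ord0 ord0)) (none (lift ord0 (lift ord0 ord0))).
  lia.
exists (fun J => \sum_(m <- msupp g | Jm m == J) g@_m *: 'X_[m - word_mnm J *+ E]).
split=> [J|].
  rewrite big_seq_cond; apply: (@row_homog_sum k d) => m /andP[mg /eqP <-].
  apply: row_homogZ => m'; rewrite msuppX inE => /eqP -> i.
  transitivity (\sum_(j < 3) (m (mxvec_index i j) - (j == Jm m i) * E))%N.
    by apply: eq_bigr => j _; rewrite mnmBE mulmnE word_mnmE.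
  rewrite sumnB => [|j _].
    rewrite (hg m mg) (bigD1 (Jm m i)) //= eqxx big1 ?mul1n ?addn0 // => j.
    by move=> /negbTE ->.
  by have /mnm_lepP/(_ (mxvec_index i j)) := JmP m mg; rewrite mulmnE word_mnmE.
rewrite {1}[g]mpolyE (partition_big Jm xpredT) //=; apply: eq_bigr => J _.
rewrite big_seq_cond mulr_suml [RHS]big_seq_cond.
apply: eq_bigr => m /andP[mg /eqP mJ].
by rewrite -scalerAl chart_monE mpolyXn -mpolyXD submK // -mJ JmP.
Qed.

Definition mnm_supp (m : 'X_{1..d * 3}) : {set 'I_(d * 3)} :=
  [set l | m l != 0%N].

Variable face : pred {set 'I_(d * 3)}.
Hypothesis face_sub : forall X Y : {set 'I_(d * 3)}, X \subset Y -> face Y -> face X.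

(* The Stanley-Reisner ideal of the simplicial complex face. *)
Definition face_ideal (f : poly) : Prop :=
  forall m, m \in msupp f -> ~~ face (mnm_supp m).

Lemma face_ideal0 : face_ideal 0.
Proof. by move=> m; rewrite msupp0. Qed.

Lemma face_idealD f g : face_ideal f -> face_ideal g -> face_ideal (f + g).
Proof. by move=> hf hg m /msuppD_le; rewrite mem_cat => /orP[/hf|/hg]. Qed.

Lemma face_idealM f g : face_ideal g -> face_ideal (f * g).
Proof.
move=> hg m /msuppM_le/allpairsP[[m1 m2] /= [_ /hg + ->]].
apply: contra; apply: face_sub; apply/subsetP => l.
by rewrite !inE mnmDE addn_eq0 => /negbTE ->; rewrite andbF.
Qed.

Lemma face_idealB f g : face_ideal f -> face_ideal g -> face_ideal (f - g).
Proof.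
by move=> hf hg; apply: face_idealD => //; rewrite -[- g]mulN1r; apply: face_idealM.
Qed.

Lemma face_ideal_sum (I : Type) (r : seq I) (P : pred I) (F : I -> poly) :
  (forall i, P i -> face_ideal (F i)) -> face_ideal (\sum_(i <- r | P i) F i).
Proof.
by move=> hF; apply: (big_ind face_ideal) => //;
  [exact: face_ideal0|exact: face_idealD].
Qed.

Lemma face_idealP f :
  face_ideal f <-> forall m, face (mnm_supp m) -> f@_m = 0.
Proof.
split=> hf m; last by apply: contraTN => /hf/eqP; rewrite mcoeff_eq0.
by apply: contraTeq; rewrite -mcoeff_msupp => /hf.
Qed.

(** The degree is positive in each factor, so for every monomial of [f] there is a chart [K] inside
    its support. Multiplying by powers of that chart monomial leaves the support unchanged. *)
Lemma face_ideal_saturated e N f : multihomog e.+1 f ->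
  (forall K, face_ideal (chart_mon k K ^+ N * f)) -> face_ideal f.
Proof.
move=> hf hN m mf.
pose K : chart := [ffun i => odflt ord0 [pick j | m (mxvec_index i j) != 0%N]].
have Km i : m (mxvec_index i (K i)) != 0%N.
  rewrite ffunE; case: pickP => //= none.
  have := hf m mf i; rewrite big1 // => j _.
  by apply/eqP/negbFE/none.
have /hN : (word_mnm K *+ N + m)%MM \in msupp (chart_mon k K ^+ N * f).
  by rewrite mcoeff_msupp mcoeff_chart_monX -mcoeff_msupp.
apply: contra; apply: face_sub; apply/subsetP => l.
rewrite !inE mnmDE addn_eq0 negb_and => /orP[|//].
case/mxvec_indexP: l => i j; rewrite mulmnE word_mnmE.
by case: (j =P K i) => [->|_] //; rewrite mul0n.
Qed.

Variables A B : 'M[k]_3.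
Hypothesis BA1 : B *m A = 1%:M.

(** The equation of the standard chart [J] written in the new coordinates. Sections are given on
    these charts, while the monomial argument runs on the charts [chart_mon k K] of the new
    coordinates. *)
Local Notation form J := (row_subst A (chart_mon k J)).

(** The standard charts cover each chart of the new coordinates: substitute [B], apply the
    pigeonhole decomposition, and return by [A]. *)
Lemma chart_mon_cover E K : exists a : chart -> poly,
  (forall J, multihomog (2 * E) (a J)) /\
  chart_mon k K ^+ (3 * E) = \sum_J a J * form J ^+ E.
Proof.
have hK : multihomog (3 * E) (row_subst B (chart_mon k K ^+ (3 * E))).
  by apply: (@row_homog_subst k d); apply: multihomog_chart_mon.
have [a [ha /(congr1 (row_subst A))]] := pigeonhole_charts hK (leqnn _).
rewrite row_subst_comp BA1 row_subst1 => ->.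
exists (fun J => row_subst A (a J)); split=> [J|].
  apply: (@row_homog_subst k d).
  by have := ha J; rewrite -{2}[E]mul1n -mulnBl.
by rewrite rmorph_sum; apply: eq_bigr => J _; rewrite rmorphM rmorphXn.
Qed.

Lemma form_saturated e E f : multihomog e.+1 f ->
  (forall J, face_ideal (form J ^+ E * f)) -> face_ideal f.
Proof.
move=> hf hE; apply: (face_ideal_saturated (N := 3 * E) hf) => K.
have [a [_ ->]] := chart_mon_cover E K.
rewrite mulr_suml; apply: face_ideal_sum => J _.
by rewrite -mulrA; apply: face_idealM.
Qed.

(** The local sections are [f J / form J ^+ E]. They are transferred to the charts of the new
    coordinates, where coefficients can be compared monomial by monomial, and the result is brought
    back to the charts [J] by saturation. *)
Lemma glue_forms E (f : chart -> poly) :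
  (forall J, multihomog E.+1 (f J)) ->
  (forall J J', face_ideal (form J' ^+ E * f J - form J ^+ E * f J')) ->
  exists c : chart -> k, forall J,
    face_ideal (f J - form J ^+ E *
      \sum_(w | face (mnm_supp (word_mnm w))) c w *: chart_mon k w).
Proof.
move=> hf hff; have /fin_all_exists[a ha] := chart_mon_cover E.
(* Since [chart_mon k K ^+ M] is the sum of the [a K J * form J ^+ E], the fraction
   [t K / chart_mon k K ^+ M] is the given section on chart [K]. *)
pose M := (3 * E)%N; pose t K := \sum_J a K J * f J.
have t_homog K : multihomog M.+1 (t K).
  apply: (@row_homog_sum k d) => J _; have -> : M.+1 = (2 * E + E.+1)%N by lia.
  by apply: multihomogM => //; apply: (ha K).1.
have t_form J K : face_ideal (form J ^+ E * t K - chart_mon k K ^+ M * f J).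
  rewrite (ha K).2 mulr_suml mulr_sumr -sumrB; apply: face_ideal_sum => J' _.
  rewrite mulrCA -mulrA -mulrBr; exact: face_idealM.
have t_comp K K' :
    face_ideal (chart_mon k K' ^+ M * t K - chart_mon k K ^+ M * t K').
  apply: (form_saturated (e := M + M) (E := E)) => [|J].
    by apply: row_homogB; rewrite -addnS; apply: multihomogM => //;
      apply: multihomog_chart_mon.
  have -> : form J ^+ E * (chart_mon k K' ^+ M * t K - chart_mon k K ^+ M * t K')
      = chart_mon k K' ^+ M * (form J ^+ E * t K - chart_mon k K ^+ M * f J)
      - chart_mon k K ^+ M * (form J ^+ E * t K' - chart_mon k K' ^+ M * f J).
    by ring.
  by apply: face_idealB; apply: face_idealM.
(* Dividing by the denominator [chart_mon k w ^+ M] turns the exponent [M.+1] into 1: this is the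
   coefficient of the word [w] in the section on its own chart. *)
pose c w := (t w)@_(word_mnm w *+ M.+1); exists c.
set F := \sum_(w | _) _.
have F_homog : multihomog 1 F.
  apply: (@row_homog_sum k d) => w _; apply: row_homogZ.
  by rewrite -[chart_mon k w]expr1; apply: multihomog_chart_mon.
have F_word w : face (mnm_supp (word_mnm w)) -> F@_(word_mnm w) = c w.
  move=> fw; rewrite raddf_sum (bigD1 w) //= mcoeffZ chart_monE mcoeffX eqxx mulr1.
  rewrite big1 ?addr0 // => w' /andP[_ ww'].
  by rewrite mcoeffZ chart_monE mcoeffX (inj_eq word_mnm_inj) (negbTE ww') mulr0.
(* Only the monomials whose support stays a face after adding [K] survive on the chart where
   [chart_mon k K] is invertible. *)
have t_coef K m : face (mnm_supp (word_mnm K *+ 1 + m)%MM) ->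
    (t K)@_m = (chart_mon k K ^+ M * F)@_m.
  move=> fm; case: (boolP [forall i, M <= m (mxvec_index i (K i))]%N); last first.
    move=> /forallPn[i]; rewrite -ltnNge => mM.
    rewrite (mcoeff_chart_monX_eq0 F mM); apply/eqP.
    apply: contraT; rewrite -mcoeff_msupp => mt; have hm := t_homog K m mt i.
    have [j jK mj] : exists2 j, j != K i & m (mxvec_index i j) != 0%N.
      apply/exists_inP; apply: contraT => /exists_inPn none.
      move: hm; rewrite (bigD1 (K i)) //= big1 ?addn0 => [hm|j jK].
        by rewrite hm ltnNge leqnSn in mM.
      by apply/eqP/negPn/none.
    (* t_K and t_K' agree up to u_K' ^ M and u_K ^ M, and u_K ^ M does not divide
       u_K' ^ M m. *)
    pose K' : chart := [ffun i' => if i' == i then j else K i'].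
    have /face_idealP/(_ (word_mnm K' *+ M + m)%MM) := t_comp K K'.
    rewrite mcoeffB mcoeff_chart_monX (@mcoeff_chart_monX_eq0 K M _ _ i); last first.
      by rewrite mnmDE mulmnE word_mnmE ffunE eqxx eq_sym (negbTE jK).
    rewrite subr0 => tK0; rewrite mcoeff_msupp in mt; case/eqP: mt; apply: tK0.
    apply: face_sub fm; apply/subsetP => l; case/mxvec_indexP: l => i' j'.
    rewrite !inE !mnmDE !mulmnE !word_mnmE ffunE !addn_eq0 !negb_and.
    case: (m _ =P 0%N) => [m0|_]; last by rewrite !orbT.
    have [ii'|_] := eqVneq i' i; last by case: (j' == K i'); rewrite ?mul0n.
    have [jj'|_] := eqVneq j' j; last by rewrite mul0n.
    by move: mj; rewrite -ii' -jj' m0.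
  move=> /forallP mM; pose m' := (m - word_mnm K *+ M)%MM.
  have mE : m = (word_mnm K *+ M + m')%MM.
    rewrite addmC submK //; apply/mnm_lepP => l; case/mxvec_indexP: l => i j.
    by rewrite mulmnE word_mnmE; case: (j =P K i) => [->|_]; rewrite ?mul1n.
  rewrite mE mcoeff_chart_monX.
  (* The quotient monomial [m'] either has the wrong multidegree, and both coefficients vanish, or
     is a word [w]. *)
  case: (boolP [forall i, \sum_(j < 3) m' (mxvec_index i j) == 1]%N); last first.
    move=> /forallPn[i /eqP hi].
    have -> : F@_m' = 0.
      by apply/eqP; rewrite mcoeff_eq0; apply/negP => /F_homog.
    apply/eqP; rewrite mcoeff_eq0 -mE; apply/negP => /t_homog/(_ i) hm.
    apply: hi; apply/eqP; rewrite -(eqn_add2l M) addn1 -hm mE.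
    under [X in _ == X]eq_bigr => j _ do rewrite mnmDE mulmnE word_mnmE.
    rewrite big_split /= eqn_add2r (bigD1 (K i)) //= eqxx mul1n big1 ?addn0 // => j.
    by move=> /negbTE ->.
  move=> /forallP hm'; have [w wE] : exists w, m' = word_mnm w.
    by apply: word_mnmP => i; apply/eqP.
  have supp_sub n1 n2 : mnm_supp (word_mnm w *+ n1 + (word_mnm K *+ n2 + word_mnm w))%MM
      \subset mnm_supp (word_mnm K *+ 1 + m)%MM.
    apply/subsetP => l; rewrite mE wE !inE !mnmDE !mulmnE !addn_eq0 !muln_eq0.
    by case: (word_mnm w l == 0%N); case: (word_mnm K l == 0%N).
  rewrite wE F_word; last first.
    apply: face_sub fm; apply: subset_trans (supp_sub 0%N 0%N).
    by apply/subsetP => l; rewrite !inE !mnmDE !mulmnE; lia.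
  (* Comparison with the chart [w]: at this monomial the two terms contribute the coefficient of
     [t K] in question and [c w]. *)
  have /face_idealP/(_ (word_mnm w *+ M + (word_mnm K *+ M + word_mnm w))%MM) :=
    t_comp K w.
  rewrite mcoeffB mcoeff_chart_monX addmA [(_ *+ M + _ *+ M)%MM]addmC -addmA.
  rewrite mcoeff_chart_monX /c mulmSr => tK; apply/eqP; rewrite -subr_eq0.
  apply/eqP/tK; apply: face_sub fm.
  by rewrite addmA [(_ *+ M + _ *+ M)%MM]addmC -addmA.
(* The extra factor puts [K] into the support of every monomial, as [t_coef] requires. *)
have t_F K : face_ideal (chart_mon k K * (t K - chart_mon k K ^+ M * F)).
  apply/face_idealP => m fm.
  case: (boolP [exists i, m (mxvec_index i (K i)) == 0%N]) =>
      [/existsP[i /eqP mi]|/existsPn mK].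
    by rewrite -[chart_mon k K]expr1 (@mcoeff_chart_monX_eq0 K 1 _ m i) // mi.
  have mE : m = (word_mnm K *+ 1 + (m - word_mnm K *+ 1))%MM.
    rewrite addmC submK //; apply/mnm_lepP => l; case/mxvec_indexP: l => i j.
    rewrite mulmnE word_mnmE muln1; case: (j =P K i) => [->|_] //.
    by rewrite lt0n mK.
  rewrite mE -{1}[chart_mon k K]expr1 mcoeff_chart_monX mcoeffB t_coef ?subrr //.
  by rewrite -mE.
(* In [M.+1], the [M] comes from [t_form] and the 1 from [t_F]. *)
move=> J; apply: (face_ideal_saturated (e := E) (N := M.+1)) => [|K].
  have formE : multihomog E (form J ^+ E).
    rewrite -rmorphXn /=; apply: (@row_homog_subst k d).
    exact: multihomog_chart_mon.
  have := multihomogM formE F_homog; rewrite addn1 => FJ.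
  exact: (row_homogB (hf J) FJ).
have -> : chart_mon k K ^+ M.+1 * (f J - form J ^+ E * F)
    = form J ^+ E * (chart_mon k K * (t K - chart_mon k K ^+ M * F))
    - chart_mon k K * (form J ^+ E * t K - chart_mon k K ^+ M * f J).
  by rewrite exprS; ring.
by apply: face_idealB; apply: face_idealM.
Qed.

End FaceIdeal.

(** * Global sections *)

(** Provides one denominator exponent for all of the finitely many charts. *)
Lemma eventually_all (T : finType) (P : T -> nat -> Prop) :
  (forall x, exists n, forall m, (n <= m)%N -> P x m) ->
  exists n, forall x m, (n <= m)%N -> P x m.
Proof.
move=> /fin_all_exists[n hn]; exists (\max_x n x) => x m nm; apply: hn.
exact: leq_trans (leq_bigmax x) nm.
Qed.

Lemma sub_frac_eq (F : fieldType) (a b p q h : F) : a != 0 -> b != 0 ->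
  p / a - q / b = h / (a * b) -> h = b * p - a * q.
Proof.
move=> a0 b0 /(canLR (divfK (mulf_neq0 a0 b0))) <-.
by field; rewrite a0 b0.
Qed.

Section Submodules.
Variables (k : nzRingType) (V : lmodType k) (U : V -> Prop).
Hypothesis subU : submod U.

Lemma submodB u v : U u -> U v -> U (u - v).
Proof. by move=> hu hv; rewrite addrC -scaleN1r; apply: subU.2. Qed.

Lemma submod_sum (J : Type) (r : seq J) (P : pred J) (c : J -> k) (F : J -> V) :
  (forall i, P i -> U (F i)) -> U (\sum_(i <- r | P i) c i *: F i).
Proof.
move=> hF; apply: big_rec => [|i v Pi Uv]; first exact: subU.1.
by apply: subU.2 => //; apply: hF.
Qed.

End Submodules.

Section FaceSections.
Import mpoly.
Variables (k : closedFieldType) (d : nat).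
Local Notation poly := {mpoly k[d * 3]}.
Local Notation chart := (chart d).

Lemma to_rat_inj : injective (@to_rat k (d * 3)).
Proof. by move=> f g /eqP; rewrite -subr_eq0 -rmorphB to_rat_eq0 subr_eq0 => /eqP. Qed.

Lemma to_ratZ c (f : poly) : to_rat (c *: f) = c *: to_rat f.
Proof. by rewrite -mul_mpolyC rmorphM. Qed.

Lemma to_rat_mon_neq0 J e : to_rat (chart_mon k J) ^+ e != 0 :> ratfun k (d * 3).
Proof. by rewrite expf_neq0 // to_rat_eq0 chart_mon_neq0. Qed.

Lemma div_raise (f m : poly) e n : m != 0 ->
  to_rat f / to_rat m ^+ e = to_rat (m ^+ n * f) / to_rat m ^+ (n + e).
Proof.
rewrite -to_rat_eq0 => m0; have mX i := expf_neq0 i m0.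
rewrite rmorphM rmorphXn exprD /=.
by rewrite -mulf_div divff ?mX // mul1r.
Qed.

Lemma twist1_raise (J : chart) u : twist1 J u ->
  exists n, forall m, (n <= m)%N -> exists f,
    multihomog m.+1 f /\ u = to_rat f / to_rat (chart_mon k J) ^+ m.
Proof.
move=> [e [f [hf ->]]]; exists e => m em.
exists (chart_mon k J ^+ (m - e) * f); split.
  rewrite -(subnK em) -addnS; rewrite addnK; apply: multihomogM => //.
  exact: multihomog_chart_mon.
by rewrite (div_raise _ _ (m - e) (chart_mon_neq0 k J)) subnK.
Qed.

Lemma loc_ideal_raise (I : ideal poly) p u : p != 0 -> loc_ideal I p u ->
  exists n, forall m, (n <= m)%N -> exists f,
    I f /\ u = to_rat f / to_rat p ^+ m.
Proof.
move=> p0 [e [f [If ->]]]; exists e => m em.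
exists (p ^+ (m - e) * f); split.
  by rewrite -[_ * f]mulr1; apply: ideal_memM.
by rewrite (div_raise _ _ (m - e) p0) subnK.
Qed.

Variable face : pred {set 'I_(d * 3)}.
Hypothesis face_sub : forall X Y : {set 'I_(d * 3)}, X \subset Y -> face Y -> face X.
Variables A B : 'M[k]_3.
Hypothesis BA1 : B *m A = 1%:M.
Variable I : ideal poly.
Hypothesis I_face : forall f, I f <-> face_ideal face (row_subst A f).

Definition face_words : {set chart} :=
  [set w | face (mnm_supp (word_mnm w))].

Definition word_comb (c : 'rV[k]_#|face_words|) : poly :=
  row_subst B (\sum_(i < #|face_words|) c 0 i *: chart_mon k (enum_val i)).

Definition word_section (i : 'I_#|face_words|) : {ffun chart -> ratfun k (d * 3)} :=
  [ffun=> to_rat (row_subst B (chart_mon k (enum_val i)))].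

Lemma word_section_comb (c : 'rV[k]_#|face_words|) J :
  (\sum_i c 0 i *: word_section i) J = to_rat (word_comb c).
Proof.
rewrite sum_ffunE /word_comb linear_sum rmorph_sum; apply: eq_bigr => i _.
by rewrite !ffunE linearZ /= to_ratZ.
Qed.

(** By saturation the combination lies in the Stanley-Reisner ideal, but all its monomials are
    faces. This gives independence both for global sections and, through multilinearization, for the
    Sklyanin algebra. *)
Lemma word_comb_eq0 c :
  (forall J, loc_ideal I (chart_mon k J) (to_rat (word_comb c))) -> c = 0.
Proof.
move=> hc; have [E hE] := eventually_all (fun J =>
  loc_ideal_raise (chart_mon_neq0 k J) (hc J)).
set F := \sum_(i < #|face_words|) c 0 i *: chart_mon k (enum_val i).
have F1 : multihomog 1 F.
  apply: (@row_homog_sum k d) => w _; apply: row_homogZ.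
  by rewrite -[chart_mon k _]expr1; apply: multihomog_chart_mon.
have /face_idealP hF : face_ideal face F.
  apply: (form_saturated face_sub BA1 F1 (E := E)) => J.
  have [f [If /(canLR (divfK (to_rat_mon_neq0 J E)))]] := hE J E (leqnn E).
  rewrite -rmorphXn -rmorphM => /to_rat_inj fE.
  move/I_face: If; rewrite -fE rmorphM rmorphXn /= row_subst_comp BA1 row_subst1.
  by rewrite mulrC.
apply/rowP => i; rewrite mxE.
have := enum_valP i; rewrite inE => /hF <-.
rewrite raddf_sum (bigD1 i) //= mcoeffZ chart_monE mcoeffX eqxx mulr1.
rewrite big1 ?addr0 // => j ji.
by rewrite mcoeffZ chart_monE mcoeffX (inj_eq (@word_mnm_inj d))
  (inj_eq enum_val_inj) (negbTE ji) mulr0.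
Qed.

Lemma word_section_cocycle i : cocycle I (word_section i).
Proof.
split=> [J|J J']; rewrite !ffunE.
  exists 0%N, (row_subst B (chart_mon k (enum_val i))); split.
    apply: (@row_homog_subst k d).
    by rewrite -[chart_mon k _]expr1; apply: multihomog_chart_mon.
  by rewrite expr0 divr1.
rewrite subrr; apply: (loc_ideal_submod I _).1.
by rewrite mulf_neq0 ?chart_mon_neq0.
Qed.

(** Existence of the coordinates of a section is [glue_forms]; their uniqueness is
    [word_comb_eq0]. *)
Lemma has_dim_face_sections : has_dim (H0 I) #|face_words|.
Proof.
exists word_section; split=> [i|v]; first exact: word_section_cocycle.
move=> v_num; have [hv hvv] : cocycle I v := v_num.
have [E1 hE1] := eventually_all (fun J => twist1_raise (hv J)).
have mm0 (JJ : chart * chart) : chart_mon k JJ.1 * chart_mon k JJ.2 != 0.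
  by rewrite mulf_neq0 ?chart_mon_neq0.
have [E2 hE2] := eventually_all (fun JJ =>
  loc_ideal_raise (mm0 JJ) (hvv JJ.1 JJ.2)).
(* One exponent has to serve both the sections and their differences on overlaps. *)
pose E := maxn E1 E2.
have /fin_all_exists[f hf] := fun J => hE1 J E (leq_maxl _ _).
have [c hc] : exists c : 'rV_#|face_words|, forall J,
    loc_ideal I (chart_mon k J) (v J - to_rat (word_comb c)).
  have [J|J J'|c hc] := glue_forms face_sub BA1 (E := E)
      (f := fun J => row_subst A (f J)).
  - apply: (@row_homog_subst k d); exact: (hf J).1.
  - have [h [/I_face Ih]] := hE2 (J, J') E (leq_maxr _ _).
    rewrite (hf J).2 (hf J').2 /= rmorphM exprMn => hE.
    suff /to_rat_inj hE' :
        to_rat (chart_mon k J' ^+ E * f J - chart_mon k J ^+ E * f J')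
        = to_rat h.
      by move: Ih; rewrite -hE' rmorphB !rmorphM !rmorphXn.
    have a0 := to_rat_mon_neq0 J E; have b0 := to_rat_mon_neq0 J' E.
    have -> := sub_frac_eq a0 b0 hE.
    by rewrite rmorphB !rmorphM !rmorphXn.
  exists (\row_i c (enum_val i)) => J.
  exists E, (f J - chart_mon k J ^+ E * word_comb (\row_i c (enum_val i))); split.
    apply/I_face; rewrite rmorphB rmorphM rmorphXn /= row_subst_comp BA1 row_subst1.
    under eq_bigr => i _ do rewrite mxE.
    have <- : \sum_(w in face_words) c w *: chart_mon k w =
      \sum_(i < #|face_words|) c (enum_val i) *: chart_mon k (enum_val i).
      exact: big_enum_val.
    under eq_bigl => w do rewrite inE.
    exact: hc.
  rewrite rmorphB rmorphM rmorphXn mulrBl -(hf J).2 /=.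
  by rewrite [_ * to_rat (word_comb _)]mulrC mulfK ?to_rat_mon_neq0.
(* The cocycle half of [zero_on] is automatic for such differences. *)
have zero_onP (c' : 'rV_#|face_words|) :
    zero_on I (v - \sum_i c' 0 i *: word_section i) <->
    forall J, loc_ideal I (chart_mon k J) (v J - to_rat (word_comb c')).
  split=> [[_ h] J|h]; last split=> [|J].
  - by have := h J; rewrite !ffunE word_section_comb.
  - apply: (submodB (cocycle_submod I)) => //.
    by apply: (submod_sum (cocycle_submod I)) => i _; apply: word_section_cocycle.
  - by rewrite !ffunE word_section_comb.
exists c; split=> [|c' /zero_onP hc']; first exact/zero_onP.
apply/eqP; rewrite -subr_eq0; apply/eqP/word_comb_eq0 => J.
have := submodB (loc_ideal_submod I (chart_mon_neq0 k J)) (hc' J) (hc J).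
rewrite opprB addrC addrA subrK -rmorphB /=.
congr (loc_ideal I _ (to_rat _)); rewrite /word_comb -raddfB -sumrB /=.
by congr (row_subst B _); apply: eq_bigr => i _; rewrite !mxE scalerBl.
Qed.

End FaceSections.

(** * The Fourier transform and the truncated point scheme *)

Lemma ord3P (c : 'I_3) : [\/ c = 0, c = 1 | c = 2].
Proof.
case: c => [[|[|[|//]]] ?]; [constructor 1|constructor 2|constructor 3];
  exact/val_inj.
Qed.

Section Convolution.
Variables (R : nzRingType) (x y : 'I_3 -> R).

Let convolutionE c :
  \sum_a x a * y (c - a) = x 0 * y c + x 1 * y (c - 1) + x 2 * y (c - 2).
Proof.
rewrite !big_ord_recl big_ord0 addr0 addrA subr0.
have -> : lift ord0 ord0 = 1 :> 'I_3 by apply/val_inj.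
by have -> : lift ord0 (lift ord0 ord0) = 2 :> 'I_3 by apply/val_inj.
Qed.

(** Subtraction in ['I_3] is modulo 3, so the three relations are the convolutions at 0, 1 and 2.
    The ring is not assumed commutative, which covers both the relations of the algebra and the
    equations of V_d. *)
Lemma convolution_ord3_0 :
  \sum_a x a * y (0 - a) = x 1 * y 2 + x 2 * y 1 + x 0 * y 0.
Proof.
rewrite convolutionE [RHS]addrC addrA.
by congr (_ + _ * y _ + _ * y _); apply/val_inj.
Qed.

Lemma convolution_ord3_1 :
  \sum_a x a * y (1 - a) = x 0 * y 1 + x 1 * y 0 + x 2 * y 2.
Proof.
rewrite convolutionE.
by congr (_ + _ * y _ + _ * y _); apply/val_inj.
Qed.

Lemma convolution_ord3_2 :
  \sum_a x a * y (2 - a) = x 2 * y 0 + x 0 * y 2 + x 1 * y 1.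
Proof.
rewrite convolutionE addrAC [X in X + _]addrC.
by congr (_ * y _ + _ + _ * y _); apply/val_inj.
Qed.

End Convolution.

Section Fourier.
Variables (k : fieldType) (zeta : k).
Hypothesis chark : [pchar k] =i pred0.
Hypothesis hzeta : 3.-primitive_root zeta.

Definition dft : 'M[k]_3 := \matrix_(t, j) zeta ^- (t * j).
Definition dft_inv : 'M[k]_3 := \matrix_(j, t) (3%:R^-1 * zeta ^+ (j * t)).

(** Orthogonality of the characters of Z/3: off the diagonal, [w] is a cube root of unity other than
    1, so 1 + w + w^2 = 0. *)
Lemma dft_invK : dft_inv *m dft = 1%:M.
Proof.
have z0 n : zeta ^+ n != 0.
  apply: expf_neq0; apply: contra_eq_neq (prim_expr_order hzeta) => ->.
  by rewrite expr0n eq_sym oner_eq0.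
have n3 : 3%:R != 0 :> k by rewrite ((pcharf0P k).1 chark).
apply/matrixP => j s; rewrite !mxE.
pose w := zeta ^+ j / zeta ^+ s.
transitivity (3%:R^-1 * \sum_(t < 3) w ^+ t).
  rewrite mulr_sumr; apply: eq_bigr => t _; rewrite !mxE -mulrA; congr (_ * _).
  by rewrite /w expr_div_n -!exprM [(t * s)%N]mulnC.
have [js|js] := eqVneq j s.
  rewrite /w js divff // (eq_bigr (fun=> 1)) => [|t _]; last by rewrite expr1n.
  by rewrite sumr_const card_ord mulVf.
have w1 : w != 1.
  rewrite -subr_eq0 -(inj_eq (mulIf (z0 s))) mul0r mulrBl divfK // mul1r subr_eq0.
  by rewrite (eq_prim_root_expr hzeta) !modn_small.
have := subrX1 w 3; rewrite /w expr_div_n -!exprM ![(_ * 3)%N]mulnC !exprM.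
rewrite (prim_expr_order hzeta) !expr1n divr1 subrr -/w => /esym/eqP.
by rewrite mulf_eq0 subr_eq0 (negbTE w1) => /eqP ->; rewrite mulr0.
Qed.

Lemma dft_K : dft *m dft_inv = 1%:M.
Proof. exact: mulmx1C dft_invK. Qed.

Lemma dftM t a b : dft t a * dft t b = dft t (a + b).
Proof.
rewrite !mxE -invfM -exprD -mulnDr; congr _^-1; apply/eqP.
rewrite (eq_prim_root_expr hzeta) /=; apply/eqP.
by rewrite modnMmr.
Qed.

(** The convolution theorem over Z/3. An [lalgType] only lets scalars out of the left factor, so the
    same for the right factor is assumed. *)
Lemma dft_convolution (L : lalgType k) (x y : 'I_3 -> L) t :
  (forall (c : k) (f g : L), f * (c *: g) = c *: (f * g)) ->
  (\sum_a dft t a *: x a) * (\sum_b dft t b *: y b) =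
  \sum_c dft t c *: \sum_a x a * y (c - a).
Proof.
move=> scAr; rewrite mulr_suml.
under [RHS]eq_bigr => c _ do rewrite scaler_sumr.
rewrite exchange_big; apply: eq_bigr => a _ /=.
rewrite mulr_sumr (reindex_inj (addIr (- a))); apply: eq_bigr => c _ /=.
by rewrite scAr -scalerAl scalerA mulrC dftM addrC subrK.
Qed.

End Fourier.

Section TruncatedPointScheme.
Import mpoly.
Variables (k : closedFieldType) (zeta : k) (d : nat).
Hypothesis chark : [pchar k] =i pred0.
Hypothesis hzeta : 3.-primitive_root zeta.
Local Notation poly := {mpoly k[d * 3]}.
Local Notation A := (dft_inv zeta).
Local Notation B := (dft zeta).

Lemma ideal_mem_sum (I : ideal poly) (T : Type) (r : seq T) (P : pred T)
    (F : T -> poly) :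
  (forall i, P i -> I (F i)) -> I (\sum_(i <- r | P i) F i).
Proof.
by move=> hF; apply: (big_ind I) => //; [exact: ideal_mem0|exact: ideal_memD].
Qed.

Lemma ideal_memMl (I : ideal poly) f g : I g -> I (f * g).
Proof. by move=> Ig; rewrite -[_ * _]mulr1; apply: ideal_memM. Qed.

Lemma ideal_memZ (I : ideal poly) c g : I g -> I (c *: g).
Proof. by move=> Ig; rewrite -mul_mpolyC; apply: ideal_memMl. Qed.

Definition convolution (i i' : 'I_d) (c : 'I_3) : poly :=
  \sum_a hcoord k i a * hcoord k i' (c - a).

Lemma V_eqP p :
  V_eq p <-> exists (i i' : 'I_d) c, i' = i.+1 :> nat /\ p = convolution i i' c.
Proof.
rewrite /V_eq /convolution /=.
split=> [[i [i' [ii' /= [] ->]]]|[i [i' [c [ii' ->]]]]].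
- by exists i, i', 0; rewrite convolution_ord3_0.
- by exists i, i', 2; rewrite convolution_ord3_2.
- by exists i, i', 1; rewrite convolution_ord3_1.
exists i, i'; split=> //=; case: (ord3P c) => ->.
- by constructor 1; rewrite convolution_ord3_0.
- by constructor 3; rewrite convolution_ord3_1.
- by constructor 2; rewrite convolution_ord3_2.
Qed.

(** The minimal nonfaces are the supports of the products u_t u_t taken in two consecutive
    factors. *)
Definition V_face (X : {set 'I_(d * 3)}) : bool :=
  [forall i : 'I_d, forall i' : 'I_d, forall t : 'I_3,
    (i' == i.+1 :> nat) ==> ~~ ((mxvec_index i t \in X) && (mxvec_index i' t \in X))].

Lemma V_faceP (X : {set 'I_(d * 3)}) :
  reflect (forall (i i' : 'I_d) t, i' = i.+1 :> nat ->
             mxvec_index i t \in X -> mxvec_index i' t \notin X)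
          (V_face X).
Proof.
apply: (iffP forallP) => [h i i' t ii' iX|h i].
  have /forallP/(_ i')/forallP/(_ t) := h i.
  by rewrite ii' eqxx iX.
apply/forallP => i'; apply/forallP => t; apply/implyP => /eqP ii'.
by rewrite negb_and -implybE; apply/implyP; apply: h.
Qed.

Lemma V_face_sub (X Y : {set 'I_(d * 3)}) : X \subset Y -> V_face Y -> V_face X.
Proof.
move=> /subsetP XY /V_faceP hY; apply/V_faceP => i i' t ii' /XY /(hY _ _ _ ii').
by apply: contra; apply: XY.
Qed.

Lemma row_subst_dft_square i i' t :
  row_subst B (hcoord k i t * hcoord k i' t) =
  \sum_c B t c *: convolution i i' c.
Proof.
rewrite rmorphM /= !row_subst_hcoord; apply: dft_convolution => // c f g.
by rewrite -scalerAr.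
Qed.

Lemma row_subst_convolution i i' c :
  row_subst A (convolution i i' c) = \sum_t A c t *: (hcoord k i t * hcoord k i' t).
Proof.
have -> : convolution i i' c =
    row_subst B (\sum_t A c t *: (hcoord k i t * hcoord k i' t)).
  rewrite linear_sum /=.
  under eq_bigr => t _ do rewrite linearZ /= row_subst_dft_square scaler_sumr.
  rewrite exchange_big /= (bigD1 c) //= [X in _ + X]big1 ?addr0 => [|s sc].
    under eq_bigr => t _ do rewrite scalerA.
    rewrite -scaler_suml; have /matrixP/(_ c c) := dft_invK chark hzeta.
    by rewrite !mxE eqxx => ->; rewrite scale1r.
  under eq_bigr => t _ do rewrite scalerA.
  rewrite -scaler_suml; have /matrixP/(_ c s) := dft_invK chark hzeta.
  by rewrite !mxE eq_sym (negbTE sc) => ->; rewrite scale0r.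
by rewrite row_subst_comp dft_K // row_subst1.
Qed.

(** In Fourier coordinates each equation is a combination of the products u_t u_t of consecutive
    factors. Conversely a nonface monomial is divisible by such a product, which is a combination of
    the equations. *)
Lemma V_ideal_face f : V_ideal k d f <-> face_ideal V_face (row_subst A f).
Proof.
split=> [|hf].
  elim=> [|a g b f' /V_eqP[i [i' [c [ii' ->]]]] _ IH].
    by rewrite rmorph0; apply: face_ideal0.
  rewrite rmorphD /=; apply: face_idealD => //.
  rewrite !rmorphM /= mulrAC; apply: (face_idealM V_face_sub).
  rewrite row_subst_convolution; apply: face_ideal_sum => t _ m.
  rewrite -mpolyXD => /msuppZ_le; rewrite msuppX inE => /eqP ->.
  apply/negP => /V_faceP/(_ i i' t ii').
  by rewrite !inE !mnmDE !mnm1E !eqxx !addn_eq0 andbF => /(_ isT).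
have -> : f = row_subst B (row_subst A f).
  by rewrite row_subst_comp dft_invK // row_subst1.
rewrite row_substE big_seq; apply: ideal_mem_sum => m /hf.
move=> /forallPn[i /forallPn[i' /forallPn[t]]].
rewrite negb_imply negbK !inE -!lt0n => /and3P[/eqP ii' mi mi'].
apply: ideal_memZ.
(* The two variables lie in different factors, so their product divides the monomial. *)
have -> : m = (m - U_(mxvec_index i t) - U_(mxvec_index i' t)
    + (U_(mxvec_index i t) + U_(mxvec_index i' t)))%MM.
  rewrite submDA submK //; apply/mnm_lepP => l; rewrite mnmDE !mnm1E.
  case: eqP => [<-|_]; last by case: eqP => [<-|].
  by rewrite mxvec_index_eq xpair_eqE -(inj_eq val_inj i') /= ii' gtn_eqF.
rewrite !mpolyXD rmorphM; apply: ideal_memMl.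
suff : V_ideal k d (row_subst B (hcoord k i t * hcoord k i' t)) by [].
rewrite row_subst_dft_square; apply: ideal_mem_sum => c _; apply: ideal_memZ.
rewrite -[convolution _ _ _]mulr1 -[convolution _ _ _]mul1r -[_ * 1]addr0.
by apply: gen_memD; [apply/V_eqP; exists i, i', c|exact: gen_mem0].
Qed.

End TruncatedPointScheme.

(** * The degenerate Sklyanin algebra *)

Section FreeAlgebra.
Import finmap.finmap monalg.
Variable k : closedFieldType.
Local Notation free_alg := {malg k[{fmonom 'I_3}]}.
Implicit Types (f g : free_alg) (m : {fmonom 'I_3}).

Lemma malg_sumE f : f = \sum_(m <- msupp f) f@_m *: << m >>.
Proof.
rewrite {1}[f]monalgE; apply: eq_bigr => m _; apply/malgP => m'.
by rewrite mcoeffZ !mcoeffU mulrnAr mulr1.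
Qed.

Lemma malg_span (P : free_alg -> Prop) :
  submod P -> (forall m, P << m >>) -> forall f, P f.
Proof.
move=> subP hP f; rewrite [f]malg_sumE.
by apply: submod_sum => // m _; apply: hP.
Qed.

Lemma malgUM m1 m2 : << m1 >> * << m2 >> = << FMonom (m1 ++ m2) >> :> free_alg.
Proof.
rewrite malgM_def fgmulUU mulr1; congr << _ >>.
by apply/val_inj; rewrite /= fmM.
Qed.

Lemma malg_scaleAr (c : k) f g : f * (c *: g) = c *: (f * g).
Proof.
rewrite -!mul_malgC mulrA [RHS]mulrA; congr (_ * g).
rewrite [f]malg_sumE mulr_suml mulr_sumr; apply: eq_bigr => m _.
rewrite mul_malgC -scalerAl scalerA [c * _]mulrC -scalerA; congr (_ *: _).
rewrite malgM_def fgmulUU mulm1 mul1r; apply/malgP => m'.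
by rewrite mcoeffZ !mcoeffU mulrnAr mulr1.
Qed.

Lemma prod_letter (s : seq 'I_3) :
  \prod_(j <- s) letter k j = << FMonom s >>.
Proof.
elim: s => [|j s IH]; rewrite ?big_nil ?big_cons.
  by congr << _ >>; apply/val_inj; rewrite /= fm1.
by rewrite IH malgUM; congr << FMonom _ >>; rewrite fmU.
Qed.

Lemma scaler_prod_malg (I : Type) (s : seq I) (c : I -> k) (F : I -> free_alg) :
  \prod_(i <- s) (c i *: F i) = (\prod_(i <- s) c i) *: \prod_(i <- s) F i.
Proof.
elim/big_rec3: _ => [|i a b p _ ->]; first by rewrite scale1r.
by rewrite malg_scaleAr -scalerAl scalerA mulrC.
Qed.

Variable d : nat.
Local Notation chart := (chart d).

Definition word_seq (w : chart) : seq 'I_3 := fgraph w.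
Definition word_fmonom (w : chart) : {fmonom 'I_3} := FMonom (word_seq w).

Lemma nth_word_seq x0 (w : chart) (i : 'I_d) : nth x0 (word_seq w) i = w i.
Proof. exact: nth_fgraph_ord. Qed.

Lemma word_fmonom_inj : injective word_fmonom.
Proof.
move=> w w' [eqw]; apply/ffunP => i.
by rewrite -[LHS](nth_word_seq 0) eqw nth_word_seq.
Qed.

Lemma fdeg_word w : fdeg (word_fmonom w) = d.
Proof. by rewrite /fdeg size_tuple card_ord. Qed.

Lemma word_fmonomP m : fdeg m = d -> exists w, m = word_fmonom w.
Proof.
move=> md; exists [ffun i : 'I_d => nth 0 m i]; apply/val_inj => /=.
apply: (@eq_from_nth _ 0) => [|i im]; first by rewrite size_tuple card_ord.
have id : (i < d)%N by rewrite -md.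
by have /= -> := nth_word_seq 0 _ (Ordinal id); rewrite ffunE.
Qed.

Lemma big_word_seq (R : Type) (x : R) (op : Monoid.law x) (w : chart)
    (F : 'I_3 -> R) :
  \big[op/x]_(i < d) F (w i) = \big[op/x]_(j <- word_seq w) F j.
Proof.
rewrite /word_seq -codom_ffun codomE big_map.
by rewrite [index_enum _]unlock -enumT.
Qed.

Lemma homog_wordE f : free_homog d f ->
  f = \sum_w f@_(word_fmonom w) *: << word_fmonom w >>.
Proof.
move=> hf; apply/malgP => m; rewrite raddf_sum /=.
under eq_bigr => w _ do rewrite mcoeffZ mcoeffU.
have [md|md] := eqVneq (fdeg m) d.
  have [w ->] := word_fmonomP md.
  rewrite (bigD1 w) //= eqxx mulr1 big1 ?addr0 // => w' ww'.
  by rewrite (inj_eq word_fmonom_inj) (negbTE ww') mulr0.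
rewrite big1 => [|w _]; last first.
  case: eqP => [wm|_]; last by rewrite mulr0.
  by case/eqP: md; rewrite -wm fdeg_word.
by apply/eqP; apply: contraNT md => /hf ->.
Qed.

Definition sklyanin_sum (c : 'I_3) : free_alg :=
  \sum_a letter k a * letter k (c - a).

Lemma sklyanin_relP r : sklyanin_rel r <-> exists c, r = sklyanin_sum c.
Proof.
rewrite /sklyanin_rel /sklyanin_sum !expr2 /=.
split=> [[] ->|[c ->]].
- by exists 0; rewrite convolution_ord3_0.
- by exists 2; rewrite convolution_ord3_2.
- by exists 1; rewrite convolution_ord3_1.
case: (ord3P c) => ->.
- by constructor 1; rewrite convolution_ord3_0.
- by constructor 3; rewrite convolution_ord3_1.
- by constructor 2; rewrite convolution_ord3_2.
Qed.

Variable zeta : k.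
Hypothesis chark : [pchar k] =i pred0.
Hypothesis hzeta : 3.-primitive_root zeta.
Local Notation A := (dft_inv zeta).
Local Notation B := (dft zeta).

(** The Fourier coordinate u_t in the free algebra. *)
Definition free_form (t : 'I_3) : free_alg := \sum_j B t j *: letter k j.

Definition form_word (w : chart) : free_alg := \prod_(i < d) free_form (w i).

Lemma letterE j : letter k j = \sum_t A j t *: free_form t.
Proof.
under eq_bigr => t _ do rewrite scaler_sumr.
rewrite exchange_big /= (bigD1 j) //= [X in _ + X]big1 ?addr0 => [|s sj].
  under eq_bigr => t _ do rewrite scalerA.
  rewrite -scaler_suml; have /matrixP/(_ j j) := dft_invK chark hzeta.
  by rewrite !mxE eqxx => ->; rewrite scale1r.
under eq_bigr => t _ do rewrite scalerA.
rewrite -scaler_suml; have /matrixP/(_ j s) := dft_invK chark hzeta.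
by rewrite !mxE eq_sym (negbTE sj) => ->; rewrite scale0r.
Qed.

Lemma free_form_sq t :
  free_form t * free_form t = \sum_c B t c *: sklyanin_sum c.
Proof. exact/dft_convolution/malg_scaleAr. Qed.

Lemma prod_free_distr (C : 'M[k]_3) (F : 'I_3 -> free_alg) (w : chart) :
  \prod_(i < d) (\sum_t C (w i) t *: F t) =
  \sum_(v : chart) (\prod_(i < d) C (w i) (v i)) *: \prod_(i < d) F (v i).
Proof.
rewrite bigA_distr_bigA; apply: eq_bigr => v _.
exact: scaler_prod_malg.
Qed.

Lemma word_fmonom_prod w : << word_fmonom w >> = \prod_(i < d) letter k (w i).
Proof. by rewrite big_word_seq prod_letter. Qed.

Lemma word_fmonomE w : << word_fmonom w >> =
  \sum_(v : chart) (\prod_(i < d) A (w i) (v i)) *: form_word v.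
Proof.
by rewrite word_fmonom_prod -prod_free_distr; apply: eq_bigr => i _; rewrite letterE.
Qed.

Lemma form_wordE w : form_word w =
  \sum_(v : chart) (\prod_(i < d) B (w i) (v i)) *: << word_fmonom v >>.
Proof.
rewrite [LHS]prod_free_distr; apply: eq_bigr => v _.
by rewrite word_fmonom_prod.
Qed.

Lemma form_word_homog w : free_homog d (form_word w).
Proof.
rewrite form_wordE; apply: (submod_sum (free_homog_submod k d)) => v _ m.
rewrite mcoeffU; case: (_ =P m) => [<- _|_]; last by rewrite mulr0n eqxx.
exact: fdeg_word.
Qed.

Lemma V_face_word (w : chart) : reflect
    (forall i i' : 'I_d, i' = i.+1 :> nat -> w i != w i')
    (V_face (mnm_supp (word_mnm w))).
Proof.
apply: (iffP (V_faceP _)) => [h i i' ii'|h i i' t ii'].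
  by have := h i i' (w i) ii'; rewrite !inE !word_mnmE eqxx !eqb0 !negbK => /(_ isT).
rewrite !inE !word_mnmE !eqb0 !negbK => /eqP ->.
exact: h.
Qed.

(** Such a word contains a factor u_t u_t, which [free_form_sq] writes through the relations. *)
Lemma form_word_ideal w : ~~ V_face (mnm_supp (word_mnm w)) ->
  sklyanin_ideal k (form_word w).
Proof.
move=> hw; have [i [i' [ii' wi]]] : exists i i' : 'I_d, i' = i.+1 :> nat /\ w i = w i'.
  case: (boolP [exists i : 'I_d, exists i' : 'I_d,
                  (i' == i.+1 :> nat) && (w i == w i')]).
    by case/existsP=> i /existsP[i' /andP[/eqP ? /eqP ?]]; exists i, i'.
  move=> /existsPn none; case/V_face_word: hw => i i' ii'.
  by have /existsPn/(_ i') := none i; rewrite ii' eqxx.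
have wE : word_seq w = take i (word_seq w) ++ [:: w i, w i & drop i.+2 (word_seq w)].
  have sz : size (word_seq w) = d by rewrite size_tuple card_ord.
  rewrite -{1}[word_seq w](cat_take_drop i); congr (_ ++ _).
  rewrite (drop_nth 0) ?sz // nth_word_seq; congr (_ :: _).
  by rewrite (drop_nth 0) ?sz -?ii' // nth_word_seq -wi.
rewrite /form_word big_word_seq wE big_cat big_cons big_cons.
move: (\prod_(_ <- take _ _) _) (\prod_(_ <- drop _ _) _) => p q. rewrite /=.
rewrite [free_form _ * (_ * q)]mulrA [p * _]mulrA.
apply: (@ideal_memM _ (sklyanin_ideal k)); rewrite free_form_sq.
apply: (big_ind (sklyanin_ideal k)) => [||c _]; [exact: ideal_mem0|exact: ideal_memD|].
rewrite -mul_malgC -[_ * _]mulr1 -[_ * 1]addr0.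
by apply: gen_memD; [apply/sklyanin_relP; exists c|exact: gen_mem0].
Qed.

End FreeAlgebra.

Section Multilinearization.
(* A full import of mpoly would clash with the notations of monalg. *)
Import (canonicals) mpoly.
Import finmap.finmap monalg.
Variables (k : closedFieldType) (d : nat).
Local Notation free_alg := {malg k[{fmonom 'I_3}]}.
Local Notation poly := (mpoly.mpoly (d * 3) k).
Local Notation chart := (chart d).
Implicit Types (f g : free_alg) (m n : {fmonom 'I_3}).

(** Only the words of length [d] contribute. The map carries the ideal of relations into that of
    V_d, and so transfers linear independence from sections on V_d to the algebra. *)
Definition multilinearize f : poly :=
  \sum_(w : chart) f@_(word_fmonom w) *: chart_mon k w.

Lemma multilinearize_is_linear : linear multilinearize.
Proof.
move=> c f g; rewrite /multilinearize scaler_sumr -big_split /=.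
by apply: eq_bigr => w _; rewrite mcoeffD mcoeffZ scalerDl scalerA.
Qed.

HB.instance Definition _ :=
  GRing.isLinear.Build k free_alg poly _ multilinearize multilinearize_is_linear.

Lemma multilinearize_word w : multilinearize << word_fmonom w >> = chart_mon k w.
Proof.
rewrite /multilinearize (bigD1 w) //= mcoeffU eqxx scale1r big1 ?addr0 // => v vw.
by rewrite mcoeffU (inj_eq (@word_fmonom_inj d)) eq_sym (negbTE vw) scale0r.
Qed.

Lemma multilinearizeU m : fdeg m = d ->
  multilinearize << m >> = \prod_(i < d) hcoord k i (nth 0 m i).
Proof.
move=> /word_fmonomP[w ->]; rewrite multilinearize_word.
by apply: eq_bigr => i _; rewrite /= nth_word_seq.
Qed.

Lemma multilinearizeU0 m : fdeg m <> d -> multilinearize << m >> = 0.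
Proof.
move=> md; apply: big1 => w _; rewrite mcoeffU.
by case: (m =P _) => [mw|_]; [case: md; rewrite mw fdeg_word|rewrite scale0r].
Qed.

(** In total length [d], the letters of [m] and [n] give a common factor [q] and the two middle
    letters give an equation of V_d; in any other length the image is 0. *)
Lemma multilinearize_rel m n c :
  V_ideal k d (multilinearize (<< m >> * sklyanin_sum k c * << n >>)).
Proof.
pose mid a b := FMonom (m ++ [:: a; b] ++ n).
have fdeg_mid a b : fdeg (mid a b) = (size m + 2 + size n)%N.
  by rewrite -[LHS]/(size (m ++ [:: a; b] ++ n)) !size_cat addnA.
have -> : << m >> * sklyanin_sum k c * << n >> = \sum_a << mid a (c - a) >>.
  rewrite mulr_sumr mulr_suml; apply: eq_bigr => a _.
  rewrite /letter !malgUM; congr << FMonom _ >>.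
  by rewrite /= !fmU -!catA.
rewrite linear_sum /=; have [md|md] := eqVneq (size m + 2 + size n)%N d; last first.
  rewrite big1 => [|a _]; first exact: (@ideal_mem0 _ (V_ideal k d)).
  by apply: multilinearizeU0; rewrite fdeg_mid; apply/eqP.
have im : (size m < d)%N by lia.
have im' : ((size m).+1 < d)%N by lia.
pose i := Ordinal im; pose i' := Ordinal im'.
have ii' : i' != i by rewrite -val_eqE /= gtn_eqF.
(* The letters 0 in [mid 0 0] are placeholders at the two excluded positions. *)
pose q := \prod_(j < d | (j != i) && (j != i')) hcoord k j (nth 0 (mid 0 0) j).
have -> : \sum_a multilinearize << mid a (c - a) >> = q * convolution k i i' c * 1.
  rewrite mulr1 mulr_sumr; apply: eq_bigr => a _.
  rewrite multilinearizeU; last by rewrite fdeg_mid.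
  rewrite (bigD1 i) //= (bigD1 i') //= mulrC -mulrA mulrC -mulrA; congr (_ * _).
    apply: eq_bigr => j /andP[ji ji'].
    rewrite -!val_eqE /= in ji ji'; congr hcoord; rewrite !nth_cat.
    case: ltnP => // mj; case jm: (j - _)%N => [|[|l]] /=; try by exfalso; lia.
    by rewrite !subSS subn0.
  by rewrite !nth_cat ltnn subnn ltnNge leqnSn subSnn.
rewrite -[_ * 1]addr0; apply: gen_memD; last exact: gen_mem0.
by apply/V_eqP; exists i, i', c.
Qed.

Lemma multilinearize_ideal f : sklyanin_ideal k f -> V_ideal k d (multilinearize f).
Proof.
elim=> [|a r b f' /sklyanin_relP[c ->] _ IH].
  by rewrite linear0; apply: (@ideal_mem0 _ (V_ideal k d)).
rewrite linearD /=; apply: (@ideal_memD _ (V_ideal k d)) => //.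
apply: (malg_span (P := fun a => V_ideal k d (multilinearize (a * _ * b)))) => [|m].
  split=> [|x u v hu hv]; first by rewrite !mul0r linear0; apply: ideal_mem0.
  rewrite !mulrDl -!scalerAl linearP.
  by apply: (@ideal_memD _ (V_ideal k d)); [apply: ideal_memZ; exact: hu|exact: hv].
apply: (malg_span (P := fun b => V_ideal k d (multilinearize (_ * b)))) => [|n].
  split=> [|x u v hu hv]; first by rewrite mulr0 linear0; apply: ideal_mem0.
  rewrite mulrDr malg_scaleAr linearP.
  by apply: (@ideal_memD _ (V_ideal k d)); [apply: ideal_memZ; exact: hu|exact: hv].
exact: multilinearize_rel.
Qed.

Variable zeta : k.
Hypothesis chark : [pchar k] =i pred0.
Hypothesis hzeta : 3.-primitive_root zeta.
Local Notation A := (dft_inv zeta).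
Local Notation B := (dft zeta).

Lemma multilinearize_form_word w :
  multilinearize (form_word zeta w) = row_subst B (chart_mon k w).
Proof.
rewrite form_wordE linear_sum /= rmorph_prod /=.
under [RHS]eq_bigr => i _ do rewrite row_subst_hcoord.
rewrite bigA_distr_bigA; apply: eq_bigr => v _.
by rewrite linearZ /= multilinearize_word scaler_prod.
Qed.

(** The words in the u_t span, and those with a repeated adjacent letter are zero in the quotient.
    For uniqueness, the difference of two expansions is multilinearized, and [word_comb_eq0] for V_d
    applies. *)
Lemma has_dim_sklyanin : has_dim (sklyanin k d) #|face_words (@V_face d)|.
Proof.
exists (fun i => form_word zeta (enum_val i)); split=> [i|f /= hf].
  exact: form_word_homog.
pose a (v : chart) := \sum_(w : chart) f@_(word_fmonom w) * \prod_(i < d) A (w i) (v i).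
have fE : f = \sum_v a v *: form_word zeta v.
  rewrite [LHS](homog_wordE hf).
  under eq_bigr => w _ do rewrite (word_fmonomE chark hzeta) scaler_sumr.
  rewrite exchange_big; apply: eq_bigr => v _.
  by rewrite scaler_suml; apply: eq_bigr => w _; rewrite scalerA.
have homog_comb (c : 'rV_#|face_words (@V_face d)|) :
    free_homog d (f - \sum_i c 0 i *: form_word zeta (enum_val i)).
  apply: (submodB (free_homog_submod k d)) => //.
  by apply: (submod_sum (free_homog_submod k d)) => i _; apply: form_word_homog.
pose c0 : 'rV_#|face_words (@V_face d)| := \row_i a (enum_val i).
have den0 : free_homog d (f - \sum_i c0 0 i *: form_word zeta (enum_val i)) /\
    sklyanin_ideal k (f - \sum_i c0 0 i *: form_word zeta (enum_val i)).
  split; first exact: homog_comb.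
  have -> : \sum_i c0 0 i *: form_word zeta (enum_val i) =
      \sum_(w in face_words (@V_face d)) a w *: form_word zeta w.
    rewrite [RHS]big_enum_val; apply: eq_bigr => i _.
    by rewrite mxE.
  have fE2 : f = \sum_(w in face_words (@V_face d)) a w *: form_word zeta w +
      \sum_(w | w \notin face_words (@V_face d)) a w *: form_word zeta w.
    by rewrite {1}fE (bigID (mem (face_words (@V_face d)))).
  rewrite {1}fE2 addrAC subrr add0r.
  apply: (big_ind (sklyanin_ideal k)) => [||v]; [exact: ideal_mem0|exact: ideal_memD|].
  rewrite inE => hv; rewrite -mul_malgC -[_ * _]mulr1.
  by apply: (@ideal_memM _ (sklyanin_ideal k)); apply: form_word_ideal.
exists c0; split=> [|c hc]; first exact: den0.
apply/esym/eqP; rewrite -subr_eq0; apply/eqP.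
apply: (word_comb_eq0 (@V_face_sub d) (dft_K chark hzeta)
         (V_ideal_face chark hzeta)) => J.
exists 0%N, (word_comb (dft zeta) (c - c0)).
split; last by rewrite expr0 divr1.
have -> : word_comb (dft zeta) (c - c0) = multilinearize
    ((f - \sum_i c0 0 i *: form_word zeta (enum_val i))
     - (f - \sum_i c 0 i *: form_word zeta (enum_val i))).
  rewrite opprB [X in multilinearize X]addrC subrKA -sumrB [RHS]linear_sum.
  rewrite [LHS]linear_sum; apply: eq_bigr => i _ /=.
  by rewrite -scalerBl !linearZ /= multilinearize_form_word !mxE.
by apply: multilinearize_ideal; case: (submodB (sklyanin_den_submod k d) den0 hc).
Qed.

End Multilinearization.

(** * The scheme W_d *)

(** The lowest digit is the residue modulo [N]; the others follow by induction. This separates the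
    exponents in the Kronecker substitution. *)
Lemma base_digits_inj (N n : nat) (a b : 'I_n -> nat) :
  (forall i, a i < N)%N -> (forall i, b i < N)%N ->
  (\sum_i a i * N ^ i = \sum_i b i * N ^ i)%N -> a =1 b.
Proof.
elim: n a b => [|n IH] a b ha hb; first by move=> _ [].
have N0 : (0 < N)%N by apply: leq_ltn_trans (ha ord0).
have split_digits c : (\sum_(i < n.+1) c i * N ^ i =
    c ord0 + N * \sum_(i < n) c (lift ord0 i) * N ^ i)%N.
  rewrite big_ord_recl expn0 muln1 big_distrr /=; congr (_ + _)%N.
  by apply: eq_bigr => i _; rewrite /= /bump /= add1n expnS; lia.
rewrite !split_digits => eqab.
have eq0 : a ord0 = b ord0.
  have := congr1 (modn^~ N) eqab.
  by rewrite /= !(addnC (_ ord0)) !(mulnC N) !modnMDl !modn_small.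
have /IH eqS : (\sum_(i < n) a (lift ord0 i) * N ^ i =
    \sum_(i < n) b (lift ord0 i) * N ^ i)%N.
  by move/eqP: eqab; rewrite eq0 eqn_add2l eqn_pmul2l // => /eqP.
move=> i; case: (unliftP ord0 i) => [j|] -> //.
exact: eqS.
Qed.

Section Evaluation.
Import mpoly.
Variable k : closedFieldType.

(* Kronecker substitution X_i := x ^ (N ^ i), for N larger than all exponents. *)
Lemma mpoly_nonroot (n : nat) (p : {mpoly k[n]}) : p != 0 ->
  exists v : 'I_n -> k, (forall i, v i != 0) /\ p.@[v] != 0.
Proof.
move=> p0; pose N := msize p; pose e (m : 'X_{1..n}) := (\sum_i m i * N ^ i)%N.
have e_inj m m' : m \in msupp p -> m' \in msupp p -> e m = e m' -> m = m'.
  have lt_N m0 i : m0 \in msupp p -> (m0 i < N)%N.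
    move=> m0p; apply: leq_ltn_trans (msize_mdeg_lt m0p).
    by rewrite mdegE (bigD1 i) //= leq_addr.
  move=> mp m'p /base_digits_inj eqm; apply/mnmP; apply: eqm => i; exact: lt_N.
pose q := \sum_(m <- msupp p) p@_m *: 'X^(e m) : {poly k}.
have q0 : q != 0.
  have [m mp] : exists m, m \in msupp p.
    move: p0; rewrite -msupp_eq0; case: (msupp p) => // m s _.
    by exists m; rewrite mem_head.
  apply/eqP => /(congr1 (fun r : {poly k} => r`_(e m))).
  rewrite coef0 coef_sum (bigD1_seq m) ?msupp_uniq //= coefZ coefXn eqxx mulr1.
  rewrite big_seq_cond big1 => [|m' /andP[m'p m'm]].
    by rewrite addr0 => /eqP; rewrite mcoeff_eq0 mp.
  rewrite coefZ coefXn; case: eqP => [/(e_inj _ _ mp m'p) eqm|_]; last by rewrite mulr0.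
  by rewrite eqm eqxx in m'm.
(* The factor ['X] forces [x != 0], hence all coordinates of the point are nonzero. *)
have /closed_nonrootP[x] : q * 'X != 0 by rewrite mulf_neq0 // polyX_eq0.
rewrite rootE hornerM hornerX mulf_eq0 negb_or => /andP[qx x0].
exists (fun i => x ^+ (N ^ i)); split=> [i|]; first exact: expf_neq0.
suff <- : q.[x] = p.@[fun i => x ^+ (N ^ i)] by [].
rewrite horner_sum mevalE; apply: eq_bigr => m _.
rewrite hornerZ hornerXn; congr (_ * _); rewrite -prodrXr; apply: eq_bigr => i _.
by rewrite mulnC exprM.
Qed.

(** Points are rows of [v], while the forms substituted are rows of [A]; hence the transpose. *)
Lemma meval_row_subst (d : nat) (A : 'M[k]_3) (f : {mpoly k[d * 3]})
    (v : 'M[k]_(d, 3)) :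
  (row_subst A f).@[mxvec v 0] = f.@[mxvec (v *m A^T) 0].
Proof.
rewrite row_substE [RHS]mevalE raddf_sum /=; apply: eq_bigr => m _.
rewrite mevalZ row_substX rmorph_prod big_mxvec_index; congr (_ * _).
apply: eq_bigr => i _; rewrite rmorph_prod; apply: eq_bigr => j _.
rewrite rmorphXn raddf_sum mxvecE mxE /=; congr (_ ^+ _); apply: eq_bigr => t _.
by rewrite mevalZ mevalXU mxvecE mxE mulrC.
Qed.

Variables (zeta : k) (d : nat).
Hypothesis chark : [pchar k] =i pred0.
Hypothesis hzeta : 3.-primitive_root zeta.
Hypothesis d_gt1 : (1 < d)%N.
Local Notation A := (dft_inv zeta).
Local Notation B := (dft zeta).

(* In the Fourier coordinates the component W_component zeta t b consists of the
   points whose coordinate j of factor i vanishes unless W_coord t b i j. *)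
Definition W_coord (t : 'I_3) (b : bool) (i : 'I_d) (j : 'I_3) : bool :=
  (odd i == b) (+) (j == t).

(** The complex is generated by six simplices, one for each component of W_d. *)
Definition W_face (X : {set 'I_(d * 3)}) : bool :=
  [exists t, exists b, forall i, forall j, (mxvec_index i j \in X) ==> W_coord t b i j].

Lemma W_faceP (X : {set 'I_(d * 3)}) : reflect
    (exists t b, forall i j, mxvec_index i j \in X -> W_coord t b i j) (W_face X).
Proof.
apply: (iffP existsP) => [[t /existsP[b /forallP h]]|[t [b h]]].
  by exists t, b => i j; have /forallP/(_ j)/implyP := h i.
exists t; apply/existsP; exists b; apply/forallP => i; apply/forallP => j.
exact/implyP/h.
Qed.

Lemma W_face_sub (X Y : {set 'I_(d * 3)}) : X \subset Y -> W_face Y -> W_face X.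
Proof.
move=> /subsetP XY /W_faceP[t [b h]]; apply/W_faceP; exists t, b => i j /XY.
exact: h.
Qed.

Let dftTK (v : 'M[k]_(d, 3)) : v *m B^T *m A^T = v.
Proof. by rewrite -mulmxA -trmx_mul dft_invK // trmx1 mulmx1. Qed.

(** The line with index [t] is u_t = 0, and by orthogonality its vertex is the point at which u_t
    alone is nonzero. *)
Lemma W_componentP t b (v : 'M[k]_(d, 3)) : (forall i, row i v != 0) ->
  W_component zeta t b v <->
  forall i j, (v *m B^T) i j != 0 -> W_coord t b i j.
Proof.
move=> v0; have n3 : 3%:R != 0 :> k by rewrite ((pcharf0P k).1 chark).
have vB i : (v *m B^T) i t = \sum_(j < 3) zeta ^- (t * j) * row i v 0 j.
  by rewrite mxE; apply: eq_bigr => l _; rewrite !mxE mulrC.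
split=> [hv i j|hv i].
  move: (hv i); rewrite /W_coord; case: (odd i == b) => /= [side|[c c0 vc]].
    by apply: contraNN => /eqP ->; rewrite vB side.
  apply: contraNT => jt; rewrite mxE.
  (* The vertex is 3 times column [t] of [A]. *)
  have -> : \sum_l v i l * B^T l j = c * 3%:R * \sum_l B j l * A l t.
    rewrite mulr_sumr; apply: eq_bigr => l _.
    have /rowP/(_ l) := vc; rewrite !mxE => ->.
    rewrite [(t * l)%N]mulnC; move: (zeta ^- _) (zeta ^+ _) => z1 z2.
    by field.
  have /matrixP/(_ j t) := dft_K chark hzeta.
  by rewrite !mxE (negbTE jt) => ->; rewrite mulr0.
have vB0 j : ~~ W_coord t b i j -> (v *m B^T) i j = 0.
  by move=> h; apply/eqP; apply: contraNT h; apply: hv.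
move: vB0; rewrite /W_coord; case: (odd i == b) => /= vB0.
  by rewrite /on_side -vB vB0 ?eqxx.
have vE : row i v = ((v *m B^T) i t / 3%:R) *: vertex zeta t.
  apply/rowP => l; rewrite -[v in LHS]dftTK [LHS]mxE mxE (bigD1 t) //=.
  rewrite big1 ?addr0 => [|j jt]; last by rewrite vB0 ?mul0r.
  rewrite [A^T _ _]mxE [A _ _]mxE [RHS]mxE [X in _ = _ * X]mxE.
  by rewrite [(t * l)%N]mulnC mulrA.
exists ((v *m B^T) i t / 3%:R) => //.
by apply: contraNneq (v0 i) => c0; rewrite vE c0 scale0r.
Qed.

(** These monomials vanish identically on the component given by [t] and [b]. *)
Definition off_coord t b (m : 'X_{1..d * 3}) : bool :=
  [exists i : 'I_d, exists j : 'I_3,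
    (m (mxvec_index i j) != 0%N) && ~~ W_coord t b i j].

Lemma off_coordPn t b (m : 'X_{1..d * 3}) :
  reflect (forall i j, m (mxvec_index i j) != 0%N -> W_coord t b i j)
    (~~ off_coord t b m).
Proof.
apply: (iffP existsPn) => h i.
  by move=> j mij; have /existsPn/(_ j) := h i; rewrite mij negbK.
by apply/existsPn => j; apply/negP => /andP[/h ->].
Qed.

Lemma meval_off_coord t b (m : 'X_{1..d * 3}) (x : 'M[k]_(d, 3)) :
  (forall i j, ~~ W_coord t b i j -> x i j = 0) -> off_coord t b m ->
  \prod_l mxvec x 0 l ^+ m l = 0.
Proof.
move=> x0 /existsP[i /existsP[j /andP[mij ij]]].
by rewrite (bigD1 (mxvec_index i j)) //= mxvecE x0 // expr0n (negbTE mij) mul0r.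
Qed.

(** Each component is a coordinate subspace in the Fourier coordinates, and a polynomial vanishes on
    it exactly when each of its monomials does, [k] being infinite. *)
Lemma W_ideal_face f : W_ideal d zeta f <-> face_ideal W_face (row_subst A f).
Proof.
have BAT (v : 'M[k]_(d, 3)) : v *m A^T *m B^T = v.
  by rewrite -mulmxA -trmx_mul dft_K // trmx1 mulmx1.
set g := row_subst A f.
split=> [hf m mg|hg v [v0 [|[t [b /(W_componentP _ _ v0) hv]]]]].
- apply/negP => /W_faceP[t [b hm]].
  (* The restriction of [g] to the component: it contains the monomial [m], so it is nonzero at some
     [v] with nonzero coordinates, which is then projected to the component. *)
  pose p := \sum_(m <- msupp g | ~~ off_coord t b m) g@_m *: 'X_[m].
  have p0 : p != 0.
    apply/eqP => /(congr1 (mcoeff m)); rewrite raddf_sum mcoeff0 /=.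
    rewrite big_mkcond (bigD1_seq m) ?msupp_uniq //= ifT; last first.
      by apply/off_coordPn => i j mij; apply: hm; rewrite inE.
    rewrite mcoeffZ mcoeffX eqxx mulr1 big1 => [|m' m'm].
      by rewrite addr0 => /eqP; rewrite mcoeff_eq0 mg.
    by rewrite mcoeffZ mcoeffX (negbTE m'm) mulr0 if_same.
  have [v [v0 pv]] := mpoly_nonroot p0.
  pose x : 'M[k]_(d, 3) :=
    \matrix_(i, j) if W_coord t b i j then v (mxvec_index i j) else 0.
  have x0 i j : ~~ W_coord t b i j -> x i j = 0.
    by rewrite mxE => /negbTE ->.
  have gx : g.@[mxvec x 0] = p.@[v].
    rewrite mevalE raddf_sum (bigID (off_coord t b)) /=.
    rewrite big1 ?add0r => [|m' hm']; last by rewrite (meval_off_coord x0) ?mulr0.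
    apply: eq_bigr => m' /off_coordPn hm'; rewrite mevalZ mevalX; congr (_ * _).
    apply: eq_bigr => l _; case/mxvec_indexP: l => i j; rewrite mxvecE mxE.
    case: ifPn => // ij; have [->|mij] := eqVneq (m' (mxvec_index i j)) 0%N.
      by rewrite !expr0.
    by rewrite hm' in ij.
  (* Every factor keeps a coordinate: u_t at a vertex, and for instance u_(t+1) on a side. *)
  have row_x i : row i (x *m A^T) != 0.
    apply/eqP => /(congr1 (mulmxr B^T)) /=; rewrite -row_mul BAT mul0mx => /rowP xi0.
    have [j ij] : exists j, W_coord t b i j.
      rewrite /W_coord; case: (odd i == b); last by exists t; rewrite eqxx.
      by exists (t + 1); rewrite -subr_eq0 addrC addKr.
    by have := xi0 j; rewrite !mxE ij; apply/eqP/v0.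
  case/eqP: pv; rewrite -gx meval_row_subst; apply: hf; split=> //.
  right; exists t, b; apply/(W_componentP _ _ row_x) => i j.
  by rewrite BAT; apply: contraR => /x0 ->.
- by rewrite leqNgt d_gt1.
rewrite -[v]dftTK -meval_row_subst mevalE big_seq big1 // => m /hg mW.
rewrite (meval_off_coord (t := t) (b := b)) ?mulr0 // => [i j ij|].
  by apply/eqP; apply: contraNT ij; apply: hv.
apply: contraNT mW => /off_coordPn hm; apply/W_faceP; exists t, b => i j.
by rewrite inE; apply: hm.
Qed.

End Evaluation.

(** * Dimensions of B_d and P_d, and their comparison in degree 4 *)

Lemma has_dim_ppr_B (k : closedFieldType) (zeta : k) (d : nat) :
  [pchar k] =i pred0 -> 3.-primitive_root zeta ->
  has_dim (ppr_B k d) #|face_words (@V_face d)|.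
Proof.
move=> chark hzeta.
exact: (has_dim_face_sections (@V_face_sub d) (dft_K chark hzeta)
          (V_ideal_face chark hzeta)).
Qed.

Lemma has_dim_ppr_P (k : closedFieldType) (zeta : k) (d : nat) :
  [pchar k] =i pred0 -> 3.-primitive_root zeta -> (1 < d)%N ->
  has_dim (ppr_P zeta d) #|face_words (@W_face d)|.
Proof.
move=> chark hzeta d_gt1.
exact: (has_dim_face_sections (@W_face_sub d) (dft_K chark hzeta)
          (W_ideal_face chark hzeta d_gt1)).
Qed.

Lemma W_face_word (d : nat) (w : chart d) : reflect
    (exists t b, forall i, W_coord t b i (w i))
    (W_face (mnm_supp (word_mnm w))).
Proof.
apply: (iffP (W_faceP _)) => [[t [b h]]|[t [b h]]]; exists t, b => i.
  by apply: h; rewrite inE word_mnmE eqxx.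
by move=> j; rewrite inE word_mnmE eqb0 negbK => /eqP ->.
Qed.

(** On a component, of two adjacent letters exactly one equals [t], so they differ. *)
Lemma W_words_proper : face_words (@W_face 4) \proper face_words (@V_face 4).
Proof.
apply/properP; split.
  apply/subsetP => w; rewrite !inE => /W_face_word[t [b hw]].
  apply/V_face_word => i i' ii'; apply/eqP => wi.
  have := hw i'; have := hw i; rewrite /W_coord ii' wi /=.
  by case: (odd i); case: b {hw}; case: (w i' == t).
(* The word 0120: a word of W_4 is constant on the even or on the odd positions, but here these
   carry 0, 2 and 1, 0. *)
pose w : chart 4 := [ffun i : 'I_4 => inZp i].
exists w; rewrite inE.
  apply/V_face_word => i i' ii'; rewrite !ffunE -val_eqE /= ii'.
  by case: i {ii'} => [[|[|[|[|]]]]].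
apply/negP => /W_face_word[t [b hw]].
have := hw (inord 0); have := hw (inord 1); have := hw (inord 2); have := hw (inord 3).
rewrite /W_coord !ffunE !inordK //.
by case: b {hw}; case: t => [[|[|[|]]]].
Qed.

Theorem lemma7 (k : closedFieldType) (chark : [pchar k] =i pred0)
    (zeta : k) (hzeta : 3.-primitive_root zeta) :
  (forall d : nat, (d <= 4)%N ->
     exists n : nat, has_dim (ppr_B k d) n /\ has_dim (sklyanin k d) n) /\
  (exists n m : nat,
     [/\ has_dim (ppr_B k 4) n, has_dim (ppr_P zeta 4) m & n <> m]).
Proof.
split=> [d _|].
  exists #|face_words (@V_face d)|; split.
    exact: has_dim_ppr_B hzeta.
  exact: has_dim_sklyanin hzeta.
exists #|face_words (@V_face 4)|, #|face_words (@W_face 4)|; split.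
- exact: has_dim_ppr_B hzeta.
- exact: has_dim_ppr_P.
by move=> eqVW; have := proper_card W_words_proper; rewrite eqVW ltnn.
Qed.
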